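(* Let $M\ge 1$ be an integer, let $\theta_1,\dots,\theta_M$ be real with $|\theta_i|\le \frac{\pi}{2}$, let $a_1,\dots,a_M$ be complex numbers and $x_1,\dots,x_M$ nonzero complex numbers such that for all $i\ne j$ and all odd natural numbers $n,k$ we have $x_i^2n^2-x_j^2k^2\neq a_j^2-a_i^2$, and such that for each $i\neq j$ either $\operatorname{Im}(x_i/x_j)\neq 0$ or $x_i=x_j$. Then for every complex $t$ with $t^2\ne a_i^2+x_i^2n^2$ for all $1\le i\le M$ and all odd $n\ge 1$, $$\sum_{i=1}^{M}x_i\sum_{n=0}^{\infty}\frac{(-1)^n\sin((2n+1)\theta_i)}{x_i^2(2n+1)^2+a_i^2-t^2}\prod_{\substack{1\le j\le M\\ j\neq i}}\frac{\sin\left(\frac{\theta_j\sqrt{x_i^2(2n+1)^2+a_i^2-a_j^2}}{x_j}\right)}{\sqrt{x_i^2(2n+1)^2+a_i^2-a_j^2}\,\cos\left(\frac{\pi\sqrt{x_i^2(2n+1)^2+a_i^2-a_j^2}}{2x_j}\right)}$$ $$=\frac{\pi}{4}\prod_{i=1}^{M}\frac{\sin\left(\frac{\theta_i\sqrt{t^2-a_i^2}}{x_i}\right)}{\sqrt{t^2-a_i^2}\,\cos\left(\frac{\pi\sqrt{t^2-a_i^2}}{2x_i}\right)}.$$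
   Context: Each factor has the form $\frac{\sin(\theta z/x)}{z\cos(\pi z/(2x))}$, which is even in $z$, so the choice of square root $z$ is irrelevant. It has a removable singularity at $z=0$, where it is understood as its limit $\theta/x$. Empty products equal $1$. *)

(* Defs.v *)
From HB Require Import structures.
From mathcomp Require Export all_boot all_order all_algebra.
From mathcomp Require Export all_classical all_reals all_analysis.
From mathcomp Require Export complex.

Export Order.TTheory GRing.Theory Num.Theory.
Export numFieldNormedType.Exports.

#[export] Set Implicit Arguments.
#[export] Unset Strict Implicit.
#[export] Unset Printing Implicit Defensive.

Local Open Scope ring_scope.
Local Open Scope complex_scope.

Definition cexp (R : realType) (z : R[i]) : R[i] :=
  (expR (complex.Re z))%:C *
  (cos (complex.Im z) +i* sin (complex.Im z)).

Definition csin (R : realType) (z : R[i]) : R[i] :=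
  (cexp ('i * z) - cexp (- ('i * z))) / (2 * 'i).

Definition ccos (R : realType) (z : R[i]) : R[i] :=
  (cexp ('i * z) + cexp (- ('i * z))) / 2.

(* The value at the removable singularity z = 0 is the limit there. *)
Definition sin_over_zcos (R : realType) (theta : R) (x z : R[i]) : R[i] :=
  if z == 0 then theta%:C / x
  else csin (theta%:C * z / x) / (z * ccos (pi%:C * z / (2 * x))).

(* Evenness in z: the value at [sqrtC w] is the value at any square root
   of w. *)
Lemma sin_over_zcosN (R : realType) (theta : R) (x z : R[i]) :
  sin_over_zcos theta x (- z) = sin_over_zcos theta x z.
Proof.
rewrite /sin_over_zcos oppr_eq0; case: eqP => // _.
have sinN u : csin (- u) = - csin u by rewrite /csin mulrN opprK -opprB mulNr.
have cosN u : ccos (- u) = ccos u by rewrite /ccos mulrN opprK addrC.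
by rewrite !(mulrN, mulNr) sinN cosN invrN mulrNN.
Qed.

Lemma sin_over_zcos_sqrtC (R : realType) (theta : R) (x z : R[i]) :
  sin_over_zcos theta x (sqrtC (z ^+ 2)) = sin_over_zcos theta x z.
Proof.
have /eqP := sqrtCK (z ^+ 2); rewrite eqf_sqr => /orP[] /eqP -> //.
exact: sin_over_zcosN.
Qed.

(* Main.v *)
Require Import Defs.
From mathcomp Require Import ring lra zify.

Local Open Scope ring_scope.
Local Open Scope complex_scope.
Local Open Scope classical_set_scope.

(* Write [F_j(w)] for the [j]-th factor at [z = sqrt (w - a_j^2)]; as a function of [w] it
   has simple poles [p_{j,k} = a_j^2 + x_j^2 (2k+1)^2].

   The case [M = 1] is the partial fraction expansion
     [sin (theta u) / (u cos (pi u / 2))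
        = 4/pi sum_k (-1)^k sin ((2k+1) theta) / ((2k+1)^2 - u^2)].
   No contour integral is needed: with Chebyshev nodes [phi_k = (2k+1) pi / (2N)] the
   finite sum [S(m) = sum_{k<N} (-1)^k sin (m phi_k) / (cos phi - cos phi_k)] satisfies
   the recurrence of [sin (m phi)] for [m < N], hence
     [S(m) = N sin (m phi) / (sin phi cos (N phi))] for [m <= N];
   one takes [phi = pi u / (2N)], [m ~ 2 N theta / pi] and lets [N] tend to infinity by
   dominated convergence.

   The general case is an induction on the number of factors, by rearranging an
   absolutely convergent double series. Absolute convergence comes from
   [|p_{j,k} - p_{i,n}| >= c (1 + (k - n)^2)], which follows from the alternative
   "[x_i / x_j] is not real or [x_i = x_j]". *)

(** * Complex sequences and series: dominated convergence and interchange of summations *)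

Section ComplexSeries.
Variable R : realType.
Implicit Types (z w l : R[i]) (u f g : nat -> R[i]) (b : nat -> R).

(** The norm [|z|] takes its values in [R[i]]; a modulus with values in [R] puts the estimates
    within reach of [lra] and [nra]. *)
Definition cmod z : R := Normc.normc z.

Lemma normC_cmod z : `|z| = (cmod z)%:C.
Proof. by []. Qed.

Lemma cmod_ge0 z : 0 <= cmod z.
Proof. by rewrite -ler0c -normC_cmod. Qed.

Lemma cmod0 : cmod 0 = 0.
Proof. exact: Normc.normc0. Qed.

Lemma cmodM z w : cmod (z * w) = cmod z * cmod w.
Proof. exact: Normc.normcM. Qed.

Lemma cmodV z : cmod z^-1 = (cmod z)^-1.
Proof. exact: Normc.normcV. Qed.

Lemma cmodN z : cmod (- z) = cmod z.
Proof. by apply: complexI; rewrite -!normC_cmod normrN. Qed.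

Lemma cmodD z w : cmod (z + w) <= cmod z + cmod w.
Proof. by rewrite -lecR rmorphD /= -!normC_cmod ler_normD. Qed.

Lemma cmodB z w : cmod (z - w) = cmod (w - z).
Proof. by rewrite -cmodN opprB. Qed.

Lemma cmod_gt0 z : (0 < cmod z) = (z != 0).
Proof. by rewrite -ltcR -normC_cmod normr_gt0. Qed.

Lemma cmodR (x : R) : cmod x%:C = `|x|.
Proof. by rewrite /cmod /= expr0n addr0 sqrtr_sqr. Qed.

Lemma cmod_nat (n : nat) : cmod n%:R = n%:R.
Proof. by rewrite -(rmorph_nat (real_complex R)) cmodR normr_nat. Qed.

Lemma cmodX z n : cmod (z ^+ n) = cmod z ^+ n.
Proof. by apply: complexI; rewrite rmorphXn /= -!normC_cmod normrX. Qed.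

Lemma cmod_sum (I : Type) (r : seq I) (P : pred I) (F : I -> R[i]) :
  cmod (\sum_(i <- r | P i) F i) <= \sum_(i <- r | P i) cmod (F i).
Proof.
rewrite -lecR rmorph_sum /= -normC_cmod; exact: ler_norm_sum.
Qed.

Lemma Re_le_cmod z : `|complex.Re z| <= cmod z.
Proof.
by case: z => a c; rewrite /cmod /= -[leLHS]sqrtr_sqr ler_wsqrtr // lerDl sqr_ge0.
Qed.

Lemma Im_le_cmod z : `|complex.Im z| <= cmod z.
Proof.
by case: z => a c; rewrite /cmod /= -[leLHS]sqrtr_sqr ler_wsqrtr // lerDr sqr_ge0.
Qed.

(* Convergence wrapped in an inductive type: otherwise unification unfolds the
   topological structure of [R[i]^o], at prohibitive cost. *)
Variant ccvg u l : Prop := Ccvg of (u : nat -> R[i]^o) @ \oo --> (l : R[i]^o).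

Definition csum f l := ccvg (fun n => \sum_(k < n) f k) l.

Lemma ccvgP u l : ccvg u l <->
  forall e : R, 0 < e -> exists N, forall n, (N <= n)%N -> cmod (l - u n) < e.
Proof.
split=> [[/cvgrPdist_lt cul] e e0|cul].
  have [|N _ HN] := cul e%:C; first by rewrite ltcR.
  by exists N => n Nn; rewrite -ltcR -normC_cmod; exact: HN.
constructor; apply/cvgrPdist_lt => e; rewrite ltcE /= => /andP[/eqP e2 e1].
have [N HN] := cul _ e1; exists N => // n /= Nn.
suff -> : e = (complex.Re e)%:C by rewrite normC_cmod ltcR HN.
by case: (e) e2 {cul HN e1} => ? ? /= ->.
Qed.

Lemma ccvg_unique u l l' : ccvg u l -> ccvg u l' -> l = l'.
Proof. by move=> [ul] [ul']; exact: (cvg_unique (@norm_hausdorff _ R[i]^o) ul ul'). Qed.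

Lemma ccvgD u v l l' : ccvg u l -> ccvg v l' ->
  ccvg (fun n => u n + v n) (l + l').
Proof. by case=> ul [vl]; exact (Ccvg (cvgD ul vl)). Qed.

Lemma ccvgN u l : ccvg u l -> ccvg (fun n => - u n) (- l).
Proof. by case=> ul; exact (Ccvg (cvgN ul)). Qed.

Lemma ccvgM u v l l' : ccvg u l -> ccvg v l' ->
  ccvg (fun n => u n * v n) (l * l').
Proof. by case=> ul [vl]; exact (Ccvg (@cvgM R[i] _ _ _ u v l l' ul vl)). Qed.

Lemma ccvgV u l : l != 0 -> ccvg u l -> ccvg (fun n => (u n)^-1) l^-1.
Proof. by move=> l0 [ul]; exact (Ccvg (@cvgV R[i] _ _ _ u l l0 ul)). Qed.

Lemma ccvg_cst l : ccvg (fun=> l) l.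
Proof. exact (Ccvg (@cvg_cst R[i]^o l _ _ _)). Qed.

Lemma ccvg_sum (I : Type) (r : seq I) (P : pred I) (u : I -> nat -> R[i])
    (l : I -> R[i]) : (forall i, P i -> ccvg (u i) (l i)) ->
  ccvg (fun n => \sum_(i <- r | P i) u i n) (\sum_(i <- r | P i) l i).
Proof.
move=> ul; elim: r => [|i r IH].
  rewrite big_nil (_ : (fun=> _) = fun=> 0); first exact: ccvg_cst.
  by apply/funext => n; rewrite big_nil.
rewrite big_cons (_ : (fun=> _) = fun n => if P i then u i n +
    \sum_(i <- r | P i) u i n else \sum_(i <- r | P i) u i n); last first.
  by apply/funext => n; rewrite big_cons.
by case: ifP => [Pi|_]; [exact: ccvgD (ul i Pi) IH|exact: IH].
Qed.

Lemma ccvg_near u v l N : (forall n, (N <= n)%N -> u n = v n) ->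
  ccvg u l -> ccvg v l.
Proof.
move=> uv /ccvgP ul; apply/ccvgP => e /ul[N1 HN]; exists (maxn N N1) => n.
by rewrite geq_max => /andP[n1 n2]; rewrite -uv// HN.
Qed.

Lemma ccvg_shift u l N : ccvg u l -> ccvg (fun n => u (n + N)%N) l.
Proof.
move=> /ccvgP ul; apply/ccvgP => e /ul[N1 HN]; exists N1 => n N1n.
by rewrite HN// (leq_trans N1n) ?leq_addr.
Qed.

Lemma ccvg_real (u : nat -> R) (l : R) : u @ \oo --> l ->
  ccvg (fun n => (u n)%:C) l%:C.
Proof.
move=> /cvgrPdist_lt ul; apply/ccvgP => e /ul[N _ HN]; exists N => n Nn.
by rewrite -rmorphB cmodR; exact: HN.
Qed.

Lemma ccvg_ReIm u (a c : R) : (fun n => complex.Re (u n)) @ \oo --> a ->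
  (fun n => complex.Im (u n)) @ \oo --> c -> ccvg u (a +i* c).
Proof.
move=> /ccvg_real ua /ccvg_real uc; rewrite [_ +i* _]complexE /=.
have := ccvgD ua (ccvgM (ccvg_cst 'i) uc).
by apply: (ccvg_near (N := 0%N)) => n _ /=; rewrite -complexE.
Qed.

Lemma ccvg_bounded u l : ccvg u l -> exists2 B, 0 < B & forall n, cmod (u n) <= B.
Proof.
move=> /ccvgP /(_ 1 ltr01)[N HN].
exists (cmod l + 1 + \sum_(k < N) cmod (u k)).
  rewrite ltr_pwDl ?sumr_ge0// => [|i _]; last exact: cmod_ge0.
  by rewrite ltr_wpDl ?cmod_ge0.
move=> n; have S0 : 0 <= \sum_(k < N) cmod (u k).
  by rewrite sumr_ge0// => i _; exact: cmod_ge0.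
have l0 := cmod_ge0 l.
have [nN|Nn] := ltnP n N.
  rewrite (bigD1 (Ordinal nN))//= in S0 *.
  have : 0 <= \sum_(i < N | i != Ordinal nN) cmod (u i).
    by rewrite sumr_ge0// => i _; exact: cmod_ge0.
  lra.
have := HN _ Nn; have := cmodD l (- (l - u n)).
rewrite opprB addrC subrK cmodB; lra.
Qed.

Lemma cmod_le_ccvg u l (B : R) : ccvg u l -> (forall n, cmod (u n) <= B) ->
  cmod l <= B.
Proof.
move=> /ccvgP ul uB; rewrite leNgt; apply/negP => Bl.
have [|N /(_ _ (leqnn N))] := ul (cmod l - B); first by rewrite subr_gt0.
have := cmodD (l - u N) (u N); rewrite subrK; have := uB N; lra.
Qed.

Definition abs_summable f := exists B : R, forall n, \sum_(k < n) cmod (f k) <= B.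

Lemma bounded_series_tail b (B : R) : (forall k, 0 <= b k) ->
    (forall n, \sum_(k < n) b k <= B) ->
  forall e, 0 < e -> exists K, forall n, (K <= n)%N ->
    \sum_(k < n) b k - \sum_(k < K) b k < e.
Proof.
move=> b0 bB e e0.
have sbE : series b = (fun n => \sum_(k < n) b k).
  by apply/funext => n; rewrite /series /= big_mkord.
have nd : nondecreasing_seq (series b).
  by apply/nondecreasing_seqP => n; rewrite sbE/= big_ord_recr /= lerDl.
have cvb : cvgn (series b).
  apply: nondecreasing_is_cvgn => //.
  by exists B => _ [n _ <-]; rewrite sbE; exact: bB.
have /cvgrPdist_lt /(_ _ e0)[K _ HK] := cvb.
exists K => n Kn; have := HK K (leqnn K).
have := nondecreasing_cvgn_le nd cvb n; have := nondecreasing_cvgn_le nd cvb K.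
rewrite sbE /= => h1 h2; rewrite ger0_norm ?subr_ge0//.
by apply: le_lt_trans; rewrite lerB.
Qed.

Lemma cmod_series_diff f b K n : (forall k, cmod (f k) <= b k) -> (K <= n)%N ->
  cmod (\sum_(k < n) f k - \sum_(k < K) f k) <=
  \sum_(k < n) b k - \sum_(k < K) b k.
Proof.
move=> fb Kn; rewrite -!(big_mkord xpredT).
rewrite !(big_cat_nat (leq0n K) Kn)/= addrAC subrr add0r.
rewrite [leRHS]addrAC subrr add0r (le_trans (cmod_sum _ _ _))//.
exact: ler_sum.
Qed.

(** Real and imaginary parts are dominated by the modulus, so each is an absolutely convergent real
    series. *)
Lemma abs_summable_csum f : abs_summable f -> exists l, csum f l.
Proof.
move=> [B fB].
have real_case (g : nat -> R) : (forall k, `|g k| <= cmod (f k)) ->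
    exists l : R, (fun n => \sum_(k < n) g k) @ \oo --> l.
  move=> gf; have sE (h : nat -> R) : series h = (fun n => \sum_(k < n) h k).
    by apply/funext => n; rewrite /series /= big_mkord.
  exists (limn (series g)); rewrite -sE; apply: normed_cvg.
  change (cvgn (series (fun k => `|g k|))).
  apply: nondecreasing_is_cvgn.
    apply/nondecreasing_seqP => n.
    by rewrite sE big_ord_recr /= lerDl.
  exists B => _ [n _ <-]; rewrite sE (le_trans _ (fB n))//.
  exact: ler_sum.
have [a fa] := real_case (fun k => complex.Re (f k)) (fun k => Re_le_cmod _).
have [c fc] := real_case (fun k => complex.Im (f k)) (fun k => Im_le_cmod _).
exists (a +i* c); apply: ccvg_ReIm.
  by under eq_fun do rewrite (raddf_sum (@complex.Re R : Rcomplex R -> R)).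
by under eq_fun do rewrite (raddf_sum (@complex.Im R : Rcomplex R -> R)).
Qed.

(** Dominated convergence for series depending on a parameter [N]. Beyond some [K] the tails are
    small uniformly in [N], because [b] dominates them; the first [K] terms are a finite sum and
    converge termwise. *)
Lemma tannery (f : nat -> nat -> R[i]) g b (B : R) (s : nat -> R[i]) :
    (forall k, ccvg (f^~ k) (g k)) -> (forall N k, cmod (f N k) <= b k) ->
    (forall n, \sum_(k < n) b k <= B) -> (forall N, csum (f N) (s N)) ->
  exists2 l, csum g l & ccvg s l.
Proof.
move=> fg fb bB fs.
have b0 k : 0 <= b k by rewrite (le_trans (cmod_ge0 _) (fb 0%N k)).
have gb k : cmod (g k) <= b k by exact: cmod_le_ccvg (fg k) _.
have [l gl] : exists l, csum g l.
  by apply: abs_summable_csum; exists B => n; rewrite (le_trans _ (bB n))// ler_sum.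
exists l => //; apply/ccvgP => e e0.
have e4 : 0 < e / 4 by lra.
have [K HK] := bounded_series_tail b0 bB e4.
have head : ccvg (fun N => \sum_(k < K) f N k) (\sum_(k < K) g k).
  exact: ccvg_sum.
have /ccvgP /(_ _ e4)[N1 HN1] := head.
(* The choice of [K] accounts for [e / 4], and replacing the sum [m] by a partial sum for [e / 8].
   Two such tails and a head error of [e / 4] add up to [e]. *)
have tail (h : nat -> R[i]) m : (forall k, cmod (h k) <= b k) -> csum h m ->
    cmod (m - \sum_(k < K) h k) < e / 4 + e / 8.
  move=> hb /ccvgP /(_ (e / 8))[|n0 Hn0]; first by lra.
  have := Hn0 (maxn n0 K) (leq_maxl _ _).
  have := HK _ (leq_maxr n0 K).
  have := cmod_series_diff hb (leq_maxr n0 K).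
  set S1 := \sum_(k < maxn n0 K) h k; set S2 := \sum_(k < K) h k.
  have := cmodD (m - S1) (S1 - S2); rewrite addrA subrK; lra.
exists N1 => N N1N; have := HN1 _ N1N.
have := tail _ _ gb gl; have := tail _ _ (fb N) (fs N).
set S1 := \sum_(k < K) g k; set S2 := \sum_(k < K) f N k.
have := cmodD (l - S1) (S1 - S2); have := cmodD (l - S2) (S2 - s N).
rewrite !addrA !subrK (cmodB S2); lra.
Qed.

Lemma csumZ f l z : csum f l -> csum (fun k => z * f k) (z * l).
Proof.
move=> fl; rewrite /csum; under eq_fun do rewrite -mulr_sumr.
exact: ccvgM (ccvg_cst _) fl.
Qed.

Lemma csumD f g l l' : csum f l -> csum g l' -> csum (fun k => f k + g k) (l + l').
Proof.
by move=> fl gl; rewrite /csum; under eq_fun do rewrite big_split; exact: ccvgD.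
Qed.

Lemma csum_sum (I : Type) (r : seq I) (P : pred I) (f : I -> nat -> R[i])
    (l : I -> R[i]) : (forall i, P i -> csum (f i) (l i)) ->
  csum (fun n => \sum_(i <- r | P i) f i n) (\sum_(i <- r | P i) l i).
Proof.
move=> ul; rewrite /csum; under eq_fun do rewrite exchange_big/=.
exact: ccvg_sum.
Qed.

Lemma eq_csum f g l : f =1 g -> csum f l -> csum g l.
Proof. by move=> /funext ->. Qed.

(** This is [tannery] for the row sums truncated at column [N]: they tend to [r k], and their total
    over [k] is the [N]-th partial sum of [q]. *)
Lemma csum_interchange (c : nat -> nat -> R[i]) (r q : nat -> R[i]) b (B : R) :
    (forall k, csum (c k) (r k)) -> (forall n, csum (c^~ n) (q n)) ->
    (forall k N, \sum_(n < N) cmod (c k n) <= b k) ->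
    (forall n, \sum_(k < n) b k <= B) ->
  exists2 l, csum r l & csum q l.
Proof.
move=> cr cq cb bB.
apply: (@tannery (fun N k => \sum_(n < N) c k n) r b B) => //.
  by move=> N k; rewrite (le_trans (cmod_sum _ _ _)).
move=> N; exact: csum_sum.
Qed.

End ComplexSeries.

(** * Addition formulas for the complex sine and cosine *)

Section ComplexTrig.
Variable R : realType.
Implicit Types (z w : R[i]).

Lemma cexp0 : cexp (0 : R[i]) = 1.
Proof. by rewrite /cexp /= expR0 sin0 cos0 mul1r. Qed.

Lemma cexpD z w : cexp (z + w) = cexp z * cexp w.
Proof.
case: z w => [a b] [c d]; rewrite /cexp /= expRD cosD sinD.
by apply/eqP; rewrite eq_complex /=; apply/andP; split; apply/eqP; ring.
Qed.

Lemma cexpNK z : cexp z * cexp (- z) = 1.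
Proof. by rewrite -cexpD subrr cexp0. Qed.

Lemma csin_ccos_cexp z :
  cexp ('i * z) = ccos z + 'i * csin z /\ cexp (- ('i * z)) = ccos z - 'i * csin z.
Proof.
have i0 : 'i != 0 :> R[i] := neq0Ci _.
by rewrite /ccos /csin; split; field.
Qed.

Lemma ccos2Dsin2 z : ccos z ^+ 2 + csin z ^+ 2 = 1.
Proof.
have := cexpNK ('i * z); have [-> ->] := csin_ccos_cexp z => <-.
by rewrite mulrC -subr_sqr [('i * _) ^+ 2]exprMn sqrCi mulN1r opprK.
Qed.

Lemma csin_ccosD z w :
  csin (z + w) = csin z * ccos w + ccos z * csin w /\
  ccos (z + w) = ccos z * ccos w - csin z * csin w.
Proof.
have i0 : 'i != 0 :> R[i] := neq0Ci _.
rewrite [csin (z + w)]/csin [ccos (z + w)]/ccos mulrDr opprD !cexpD.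
have [-> ->] := csin_ccos_cexp z; have [-> ->] := csin_ccos_cexp w.
split; first by field.
rewrite [LHS](_ : _ = ccos z * ccos w + 'i * 'i * (csin z * csin w)).
  by rewrite -expr2 sqrCi mulN1r.
by field.
Qed.

Lemma csinN z : csin (- z) = - csin z.
Proof. by rewrite /csin mulrN opprK -opprB mulNr. Qed.

Lemma ccosN z : ccos (- z) = ccos z.
Proof. by rewrite /ccos mulrN opprK addrC. Qed.

Lemma csin0 : csin 0 = 0 :> R[i].
Proof. by rewrite /csin mulr0 oppr0 subrr mul0r. Qed.

Lemma csinDB z w : csin (z + w) + csin (z - w) = 2 * ccos w * csin z.
Proof.
by rewrite !(csin_ccosD _ _).1 csinN ccosN; ring.
Qed.

Lemma ccos_half z : 1 - ccos z = 2 * csin (z / 2) ^+ 2.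
Proof.
rewrite [in LHS](_ : z = z / 2 + z / 2); last by field.
by rewrite (csin_ccosD _ _).2 -[X in X - _](ccos2Dsin2 (z / 2)); ring.
Qed.

Lemma csin_ccos_real (x : R) : csin x%:C = (sin x)%:C /\ ccos x%:C = (cos x)%:C.
Proof.
have e1 : 'i * x%:C = 0 +i* x.
  by apply/eqP; rewrite eq_complex /=; apply/andP; split; apply/eqP; ring.
have e2 : - ('i * x%:C) = 0 +i* (- x).
  by rewrite e1; apply/eqP; rewrite eq_complex /= oppr0 !eqxx.
have [] := csin_ccos_cexp x%:C; rewrite e2 e1 /cexp /= !expR0 cosN sinN !mul1r.
set s := csin _; set c := ccos _ => h1 h2.
have i0 : 'i != 0 :> R[i] := neq0Ci _.
have h3 : 2 * c = 2 * (cos x)%:C.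
  rewrite (_ : 2 * c = (c + 'i * s) + (c - 'i * s)); last by ring.
  rewrite -h1 -h2 -?complexiE; apply/eqP; rewrite eq_complex /=.
  by apply/andP; split; apply/eqP; ring.
have h4 : (2 * 'i) * s = (2 * 'i) * (sin x)%:C.
  rewrite (_ : _ * s = (c + 'i * s) - (c - 'i * s)); last by ring.
  rewrite -h1 -h2 -?complexiE; apply/eqP; rewrite eq_complex /=.
  by apply/andP; split; apply/eqP; ring.
split; last by apply: mulfI h3.
by apply: mulfI h4; rewrite mulf_neq0.
Qed.

End ComplexTrig.

(** * Finite partial fractions over Chebyshev nodes *)

Section ChebyshevNodes.
Variables (R : realType) (n : nat).
(** These are zeros of [cos (N phi)] with [N = n.+1]; taking [n.+1] keeps the number of nodes
    positive. *)
Definition node (k : nat) : R := (2 * k + 1)%:R * (pi / (2 * n.+1%:R)).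

Lemma sin_odd_pihalf k : sin ((2 * k + 1)%:R * (pi / 2)) = (-1) ^+ k :> R.
Proof.
elim: k => [|k IH]; first by rewrite mul1r sin_pihalf.
rewrite (_ : _ * _ = (2 * k + 1)%:R * (pi / 2) + pi); last by rewrite mulnS; field.
by rewrite sinDpi IH exprS mulN1r.
Qed.

Lemma cos_odd_pihalf k : cos ((2 * k + 1)%:R * (pi / 2)) = 0 :> R.
Proof.
elim: k => [|k IH]; first by rewrite mul1r cos_pihalf.
rewrite (_ : _ * _ = (2 * k + 1)%:R * (pi / 2) + pi); last by rewrite mulnS; field.
by rewrite cosDpi IH oppr0.
Qed.

Lemma sin_natpi k : sin (k%:R * pi) = 0 :> R.
Proof.
elim: k => [|k IH]; first by rewrite mul0r sin0.
by rewrite -natr1 mulrDl mul1r sinDpi IH oppr0.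
Qed.

Let N0 : (n.+1%:R : R) != 0.
Proof. by rewrite pnatr_eq0. Qed.

Lemma node_top k : n.+1%:R * node k = (2 * k + 1)%:R * (pi / 2).
Proof. by rewrite /node; field. Qed.

(** With [al] half the step between consecutive angles, [2 cos al sin ((2k+1) al)] is
    [sin (2k al) + sin ((2k+2) al)], so the alternating sum telescopes to a multiple of
    [sin (m pi) = 0]. The bound on [m] gives [al < pi / 2], hence [cos al] can be cancelled. *)
Lemma sum_alt_sin_node m : (m < n.+1)%N ->
  \sum_(k < n.+1) (-1) ^+ k * sin (m%:R * node k) = 0.
Proof.
move=> mN; set al : R := m%:R * (pi / (2 * n.+1%:R)).
have pi0 := pi_gt0 R.
have cal : cos al != 0.
  rewrite gt_eqF// cos_gt0_pihalf//; apply/andP; split.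
    rewrite (@lt_le_trans _ _ 0)//; first by lra.
    by rewrite mulr_ge0// divr_ge0// ltW// mulr_gt0.
  rewrite /al (_ : _ * _ = pi / 2 * (m%:R / n.+1%:R)); last by field.
  by rewrite gtr_pMr ?divr_gt0// ltr_pdivrMr// mul1r ltr_nat.
have tel j : \sum_(k < j) 2 * cos al * ((-1) ^+ k * sin (m%:R * node k)) =
    - ((-1) ^+ j * sin ((2 * j)%:R * al)).
  elim: j => [|j IH]; first by rewrite big_ord0 muln0 mul0r sin0 mulr0 oppr0.
  rewrite big_ord_recr /= IH.
  rewrite (_ : m%:R * node j = (2 * j)%:R * al + al); last by rewrite /node /al; ring.
  rewrite (_ : (2 * j.+1)%:R * al = (2 * j)%:R * al + (al + al)); last by ring.
  rewrite !sinD !cosD exprS; have := cos2Dsin2 al.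
  set c := cos al; set s := sin al; set p := (-1) ^+ j.
  set a := sin _; set b := cos _ => h.
  rewrite (_ : - (-1 * p * _) = p * (a * (c ^+ 2 - s ^+ 2) + b * (2 * s * c))); last by ring.
  have -> : s ^+ 2 = 1 - c ^+ 2 by rewrite -h; ring.
  by ring.
have := tel n.+1; rewrite -mulr_sumr.
rewrite (_ : (2 * n.+1)%:R * al = m%:R * pi); last by rewrite /al natrM; field.
rewrite sin_natpi mulr0 oppr0 => /eqP.
by rewrite !mulf_eq0 (negbTE cal) pnatr_eq0 /= => /eqP.
Qed.

Variable phi : R[i].
Hypothesis phi_node : forall k, (k < n.+1)%N -> ccos phi != (cos (node k))%:C.

Definition node_sum (m : nat) : R[i] :=
  \sum_(k < n.+1) ((-1) ^+ k * sin (m%:R * node k))%:C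
     / (ccos phi - (cos (node k))%:C).

(** At each node the sines satisfy the recurrence with [cos (node k)] in place of [cos phi]; the
    difference of the two cosines cancels the denominator. *)
Lemma node_sum_rec m :
  node_sum m.+2 - 2 * ccos phi * node_sum m.+1 + node_sum m =
  - 2 * (\sum_(k < n.+1) (-1) ^+ k * sin (m.+1%:R * node k))%:C.
Proof.
rewrite /node_sum rmorph_sum /= !mulr_sumr -sumrB -big_split /=.
apply: eq_bigr => k _; have := phi_node (ltn_ord k); rewrite -subr_eq0 => d0.
have -> : sin (m.+2%:R * node k) =
    2 * cos (node k) * sin (m.+1%:R * node k) - sin (m%:R * node k).
  rewrite (_ : m.+2%:R * _ = m.+1%:R * node k + node k); last by ring.
  rewrite (_ : m%:R * _ = m.+1%:R * node k - node k); last by ring.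
  by rewrite sinD sinB; ring.
rewrite !rmorphM rmorphB !rmorphM rmorph_nat /=.
by field.
Qed.

Lemma node_sum0 : node_sum 0 = 0.
Proof.
rewrite /node_sum big1// => k _.
by rewrite mul0r sin0 mulr0 mul0r.
Qed.

(** At index [n.+1] the sines equal [(-1)^k], so the right side of the recurrence no longer
    vanishes. There the cosines are zero, which makes the values at [n] and [n.+2] equal. *)
Lemma node_sum_top : node_sum n - ccos phi * node_sum n.+1 = - n.+1%:R.
Proof.
have sym : node_sum n.+2 = node_sum n.
  apply: eq_bigr => k _; congr (_%:C / _); congr (_ * _).
  rewrite (_ : n.+2%:R * _ = n.+1%:R * node k + node k); last by ring.
  rewrite (_ : n%:R * _ = n.+1%:R * node k - node k); last by ring.
  by rewrite node_top sinD sinB cos_odd_pihalf !mul0r addr0 subr0.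
have := node_sum_rec n; rewrite sym.
rewrite (eq_bigr (fun=> 1)); last first.
  by move=> k _; rewrite node_top sin_odd_pihalf -signr_odd -expr2 sqrr_sign.
rewrite sumr_const card_ord rmorph_nat => h.
have two0 : (2 : R[i]) != 0 by rewrite pnatr_eq0.
by apply: (mulfI two0); rewrite mulrN -mulNr -h; ring.
Qed.

(* [node_sum] solves the three-term recurrence of [sin (m phi)], so it is
   proportional to any solution [V] vanishing at [0]; its value at the top index
   fixes the constant. *)
Lemma node_sumE (V : nat -> R[i]) : V 0%N = 0 -> V 1%N != 0 ->
    (forall m, V m.+2 = 2 * ccos phi * V m.+1 - V m) ->
  forall m, (m <= n.+1)%N ->
  node_sum m * (ccos phi * V n.+1 - V n) = n.+1%:R * V m.
Proof.
move=> V0 V1 Vrec.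
have prop m : (m.+1 <= n.+1)%N -> node_sum m * V 1%N = node_sum 1 * V m /\
    node_sum m.+1 * V 1%N = node_sum 1 * V m.+1.
  elim: m => [|m IH] mN; first by rewrite node_sum0 V0 mul0r mulr0.
  have [h0 h1] := IH (ltnW mN); split => //.
  have := node_sum_rec m; rewrite sum_alt_sin_node// mulr0 => /eqP.
  rewrite addr_eq0 subr_eq => /eqP ->.
  by rewrite mulrDl mulNr h0 -mulrA h1 Vrec; ring.
move=> m mN; have pm : node_sum m * V 1%N = node_sum 1 * V m.
  by case: m mN => [|m] mN; [case: (prop 0%N)|case: (prop m)].
have [pn pn1] := prop n (leqnn _).
apply: (mulIf V1); rewrite mulrAC pm mulrAC mulrBr.
rewrite (_ : node_sum 1 * (_ * _) = ccos phi * (node_sum 1 * V n.+1)); last by ring.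
rewrite -pn -pn1 mulrA -mulrBl -opprB node_sum_top opprK; ring.
Qed.

End ChebyshevNodes.

(** * Limits of rescaled trigonometric functions and elementary bounds *)

Section Limits.
Variable R : realType.
Implicit Types (z u : R[i]).

Lemma real_complex_nat n : (n%:R : R)%:C = n%:R.
Proof. exact: rmorph_nat. Qed.

Lemma diffquot_cvg (f : R -> R) (d : R) : is_derive (0 : R) (1 : R) f d ->
  (fun n : nat => n.+1%:R * (f n.+1%:R^-1 - f 0)) @ \oo --> d.
Proof.
move=> fd; have : (fun h : R => h^-1 *: (f (h *: 1 + 0) - f 0)) @ 0^' --> d.
  by rewrite -(derive_val (is_derive := fd)); exact: (ex_derive (is_derive := fd)).
move=> /cvgr_dnbhsP /(_ harmonic) hd.
have -> : (fun n : nat => n.+1%:R * (f n.+1%:R^-1 - f 0)) =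
    (fun n => (harmonic n)^-1 *: (f (harmonic n *: 1 + 0) - f 0)) :> (nat -> R).
  by apply/funext => n; rewrite /harmonic /= invrK addr0 [_ *: 1]mulr1.
apply: hd; split; last exact: cvg_harmonic.
by move=> n; rewrite invr_eq0 pnatr_eq0.
Qed.

(** Along the ray [t z] with [t] real, the real and imaginary parts of the exponential are real
    functions of [t]; their derivatives at [0] are the two parts of [z]. *)
Lemma cexp_diffquot z : ccvg (fun n => n.+1%:R * (cexp (z / n.+1%:R) - 1)) z.
Proof.
case: z => a b.
have divE n : (a +i* b) / n.+1%:R = (a * n.+1%:R^-1) +i* (b * n.+1%:R^-1) :> R[i].
  rewrite -real_complex_nat -fmorphV.
  by apply/eqP; rewrite eq_complex /=; apply/andP; split; apply/eqP; ring.
have reE n : complex.Re (n.+1%:R * (cexp ((a +i* b) / n.+1%:R) - 1)) =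
    n.+1%:R * (expR (a * n.+1%:R^-1) * cos (b * n.+1%:R^-1) - expR (a * 0) * cos (b * 0)).
  by rewrite divE -real_complex_nat /cexp /= !mulr0 expR0 cos0; ring.
have imE n : complex.Im (n.+1%:R * (cexp ((a +i* b) / n.+1%:R) - 1)) =
    n.+1%:R * (expR (a * n.+1%:R^-1) * sin (b * n.+1%:R^-1) - expR (a * 0) * sin (b * 0)).
  by rewrite divE -real_complex_nat /cexp /= !mulr0 sin0; ring.
apply: ccvg_ReIm.
  under eq_fun do rewrite reE.
  apply: (@diffquot_cvg (fun t => expR (a * t) * cos (b * t))).
  apply: is_derive_eq; rewrite !mulr0 expR0 cos0 sin0 oppr0 mul0r scaler0 add0r !scale1r.
  by rewrite mul1r [_ *: _]mulr1.
under eq_fun do rewrite imE.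
apply: (@diffquot_cvg (fun t => expR (a * t) * sin (b * t))).
apply: is_derive_eq; rewrite !mulr0 expR0 cos0 sin0 scale0r addr0 !scale1r mul1r.
by rewrite [_ *: _]mulr1.
Qed.

Lemma csin_linear_cvg z : ccvg (fun n => n.+1%:R * csin (z / n.+1%:R)) z.
Proof.
have h1 := cexp_diffquot ('i * z).
have h2 := ccvgN (cexp_diffquot (- ('i * z))).
have := ccvgM (ccvg_cst (2 * 'i)^-1) (ccvgD h1 h2).
have i0 : 'i != 0 :> R[i] := neq0Ci _.
rewrite (_ : _^-1 * _ = z); last by field.
apply: (ccvg_near (N := 0%N)) => n _.
rewrite /csin !['i * (z / _)]mulrA mulNr; set c := n.+1%:R.
have c0 : c != 0 by rewrite pnatr_eq0.
by field; rewrite i0.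
Qed.

Lemma ccos_quadratic_cvg z :
  ccvg (fun n => n.+1%:R ^+ 2 * (1 - ccos (z / n.+1%:R))) (z ^+ 2 / 2).
Proof.
have h := csin_linear_cvg (z / 2).
have := ccvgM (ccvg_cst 2) (ccvgM h h).
rewrite (_ : 2 * _ = z ^+ 2 / 2); last by field.
apply: (ccvg_near (N := 0%N)) => n _.
by rewrite ccos_half (mulrAC z); ring.
Qed.

Lemma csin_continuous_real (t : nat -> R) (l : R) u : t @ \oo --> l ->
  ccvg (fun n => csin ((t n)%:C * u)) (csin (l%:C * u)).
Proof.
move=> tl.
have ce v : ccvg (fun n => cexp ((t n)%:C * v)) (cexp (l%:C * v)).
  case: v => a b.
  have mulE (s : R) : s%:C * (a +i* b) = (s * a) +i* (s * b).
    by apply/eqP; rewrite eq_complex /=; apply/andP; split; apply/eqP; ring.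
  have cE (s : R) : cexp (s%:C * (a +i* b)) =
      (expR (s * a) * cos (s * b)) +i* (expR (s * a) * sin (s * b)).
    rewrite mulE /cexp /=.
    by apply/eqP; rewrite eq_complex /=; apply/andP; split; apply/eqP; ring.
  have tc (c : R) : (fun n => t n * c) @ \oo --> l * c by apply: cvgMl.
  rewrite cE; apply: ccvg_ReIm.
    under eq_fun do rewrite cE /=.
    apply: cvgM.
      by apply: (@continuous_cvg _ _ _ _ _ _ expR); [exact: continuous_expR|exact: tc].
    by apply: (@continuous_cvg _ _ _ _ _ _ cos); [exact: continuous_cos|exact: tc].
  under eq_fun do rewrite cE /=.
  apply: cvgM.
    by apply: (@continuous_cvg _ _ _ _ _ _ expR); [exact: continuous_expR|exact: tc].
  by apply: (@continuous_cvg _ _ _ _ _ _ sin); [exact: continuous_sin|exact: tc].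
have := ccvgM (ccvgD (ce ('i * u)) (ccvgN (ce (- ('i * u))))) (ccvg_cst (2 * 'i)^-1).
rewrite [X in ccvg _ X](_ : _ = csin (l%:C * u)); last by rewrite /csin mulrN mulrCA.
by apply: (ccvg_near (N := 0%N)) => n _; rewrite /csin mulrN mulrCA.
Qed.

(** Since [1 - cos x = 2 sin^2 (x/2)], it suffices that [sin (x/2) >= x/4]. The mean value theorem
    gives [sin y >= y cos y], so [sin (x/2) = 2 sin (x/4) cos (x/4) >= (x/2) cos^2 (x/4)], and
    [cos^2 (x/4) >= 1/2] because [cos (x/2) >= 0]. *)
Lemma cos_le_quadratic (x : R) : 0 <= x <= pi -> x ^+ 2 / 8 <= 1 - cos x.
Proof.
move=> /andP[x0 xpi].
have sinb (y : R) : 0 <= y <= pi / 2 -> y * cos y <= sin y.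
  move=> /andP[]; rewrite le_eqVlt => /predU1P[<-|y0] y2; first by rewrite mul0r sin0.
  have [c /andP[]] := MVT y0 (fun x _ => is_derive_sin x)
    (continuous_subspaceT (@continuous_sin R)).
  rewrite !bnd_simp sin0 !subr0 => c0 cy ->.
  rewrite mulrC ler_wpM2r ?ltW// ltr_cos// in_itv/=; have := pi_gt0 R; lra.
have h2 : x / 2 * cos (x / 2) <= sin (x / 2) by apply: sinb; lra.
have h4 : x / 4 * cos (x / 4) <= sin (x / 4) by apply: sinb; lra.
have e2 : x / 2 = x / 4 + x / 4 by lra.
have ex : x = x / 2 + x / 2 by lra.
have c4 : 0 <= cos (x / 4) by apply: cos_ge0_pihalf; have := pi_gt0 R; lra.
have c2 : 0 <= cos (x / 2) by apply: cos_ge0_pihalf; have := pi_gt0 R; lra.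
have -> : 1 - cos x = 2 * sin (x / 2) ^+ 2.
  by rewrite [in LHS]ex cosD -!expr2 cos2sin2; ring.
have cc : cos (x / 2) = 2 * cos (x / 4) ^+ 2 - 1.
  by rewrite e2 cosD -!expr2 sin2cos2; ring.
have s4 : x / 4 <= sin (x / 2).
  rewrite e2 sinD (_ : _ + _ = 2 * cos (x / 4) * sin (x / 4)); last by ring.
  have c4sq : 1 / 2 <= cos (x / 4) ^+ 2 by lra.
  have := ler_wpM2l c4 h4; nra.
have x4 : 0 <= x / 4 by lra.
have := ler_pM x4 x4 s4 s4; rewrite -expr2; lra.
Qed.

Lemma sum_inv_sqr_le2 n : \sum_(k < n) (k.+1%:R ^+ 2)^-1 <= 2 :> R.
Proof.
(* The sharper bound is inductive, as [1/(n+1)^2 <= 1/n - 1/(n+1)]; it also holds at [n = 0], where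
   [0^-1 = 0]. *)
suff : \sum_(k < n) (k.+1%:R ^+ 2)^-1 <= 2 - n%:R^-1 :> R.
  by move=> /le_trans; apply; rewrite gerBl invr_ge0.
elim: n => [|[|n] IH]; first by rewrite big_ord0 invr0 subr0.
  by rewrite big_ord_recr big_ord0 /= add0r expr1n invr1; lra.
rewrite big_ord_recr /= (le_trans (lerD IH (lexx _)))//.
rewrite -subr_ge0.
have n1 : (n.+1%:R : R) != 0 by rewrite pnatr_eq0.
have n2 : (n.+2%:R : R) != 0 by rewrite pnatr_eq0.
have nE : n.+2%:R = n.+1%:R + 1 :> R by rewrite natr1.
rewrite (_ : _ - _ = (n.+1%:R * n.+2%:R ^+ 2)^-1).
  by rewrite invr_ge0 mulr_ge0.
move: n1 n2; rewrite nE; move: (n.+1%:R) => c n1 n2; field.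
by rewrite n1 n2.
Qed.

End Limits.

(** * Partial fraction expansion of a single factor with [x = 1] *)

Section Expansion.
Variable R : realType.

Lemma ccvg_lower (v : nat -> R[i]) (l : R[i]) : l != 0 -> ccvg v l ->
  exists n0, forall n, (n0 <= n)%N -> cmod l / 2 <= cmod (v n).
Proof.
rewrite -cmod_gt0 => l0 /ccvgP /(_ (cmod l / 2))[|n0 hn0]; first by lra.
exists n0 => n nn0; have := hn0 n nn0; have := cmodD (l - v n) (v n).
rewrite subrK; lra.
Qed.

Variable u : R[i].
Hypothesis u_odd : forall k : nat, u ^+ 2 != (2 * k + 1)%:R ^+ 2.

Let phi n : R[i] := pi%:C * u / 2 / n.+1%:R.
(** The factor [N^2] makes these denominators converge for fixed [k], to a multiple of
    [(2k+1)^2 - u^2]. *)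
Let gap n k : R[i] := n.+1%:R ^+ 2 * (ccos (phi n) - (cos (node R n k))%:C).

Let pi0 : (0 : R) < pi := pi_gt0 R.

Let piC0 : (pi : R)%:C != 0.
Proof. by rewrite eq_complex /= eqxx andbT gt_eqF. Qed.

Lemma gapE n k : gap n k = n.+1%:R ^+ 2 * (1 - (cos (node R n k))%:C)
  - n.+1%:R ^+ 2 * (1 - ccos (phi n)).
Proof. by rewrite /gap; ring. Qed.

Lemma gap_cvg k :
  ccvg (gap^~ k) (pi%:C ^+ 2 / 8 * ((2 * k + 1)%:R ^+ 2 - u ^+ 2)).
Proof.
have := ccvgD (ccos_quadratic_cvg ((2 * k + 1)%:R * (pi / 2) : R)%:C)
  (ccvgN (ccos_quadratic_cvg (pi%:C * u / 2))).
rewrite [X in ccvg _ X](_ : _ =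
    pi%:C ^+ 2 / 8 * ((2 * k + 1)%:R ^+ 2 - u ^+ 2)); last first.
  rewrite !rmorphM /= fmorphV /= !rmorph_nat; by field.
apply: (ccvg_near (N := 0%N)) => n _; rewrite gapE; congr (_ * (_ - _) - _).
rewrite -(csin_ccos_real _).2 /node; congr ccos.
rewrite -[n.+1%:R](rmorph_nat (real_complex R)) -fmorphV -rmorphM; congr _%:C.
have : (n.+1%:R : R) != 0 by rewrite pnatr_eq0.
by move: (n.+1%:R : R) => c c0; field.
Qed.

(** The domination needed by [tannery]. For large [k] the quadratic lower bound on [1 - cos]
    outweighs the bounded contribution of [phi n]; each of the finitely many remaining [k] is
    covered by its nonzero limit, once [n] is large. *)
Lemma gap_lower : exists2 c : R, 0 < c & exists n0, forall n, (n0 <= n)%N ->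
  forall k, (k < n.+1)%N -> c * k.+1%:R ^+ 2 <= cmod (gap n k).
Proof.
have [B B0 hB] := ccvg_bounded (ccos_quadratic_cvg (pi%:C * u / 2)).
(* As [pi^2 >= 4], the node contributes at least [(k+1)^2 / 8], while [B < (k+1) / 16]; this leaves
   [(k+1)^2 / 16]. *)
have large n k : (Num.Def.trunc (16 * B) <= k)%N -> (k < n.+1)%N ->
    1 / 16 * k.+1%:R ^+ 2 <= cmod (gap n k).
  move=> Bk kn.
  have := cmodD (gap n k) (n.+1%:R ^+ 2 * (1 - ccos (phi n))).
  rewrite {1}gapE subrK; have := hB n; rewrite -/(phi n).
  set X := cmod (_ * (1 - ccos (phi n))) => XB.
  have node_itv : 0 <= node R n k <= pi.
    rewrite /node; apply/andP; split.
      by rewrite mulr_ge0// divr_ge0 ?(ltW pi0)// mulr_ge0.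
    rewrite mulrA ler_pdivrMr ?mulr_gt0// mulrC ler_wpM2l ?(ltW pi0)//.
    rewrite -natrM ler_nat; lia.
  have := cos_le_quadratic node_itv => hc.
  rewrite -(rmorph1 (real_complex R)) -rmorphB cmodM cmodX cmod_nat cmodR.
  rewrite ger0_norm ?subr_ge0 ?cos_le1// => h.
  have N20 : 0 <= n.+1%:R ^+ 2 :> R by rewrite sqr_ge0.
  have := ler_wpM2l N20 hc.
  have -> : n.+1%:R ^+ 2 * (node R n k ^+ 2 / 8) = (2 * k + 1)%:R ^+ 2 * pi ^+ 2 / 32.
    rewrite /node; have : (n.+1%:R : R) != 0 by rewrite pnatr_eq0.
    by move: (n.+1%:R : R) => c c0; field.
  have Bk1 : 16 * B < k.+1%:R.
    by rewrite (lt_le_trans (truncnS_gt _))// ler_nat.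
  have k1 : 1 <= k.+1%:R :> R by rewrite ler1n.
  have kE : (2 * k + 1)%:R = 2 * k.+1%:R - 1 :> R by rewrite natrD natrM -natr1; ring.
  have pi2 := pi_ge2 R.
  have pi4 : 4 <= pi ^+ 2 :> R by nra.
  have k2 : k.+1%:R ^+ 2 <= (2 * k + 1)%:R ^+ 2 :> R by rewrite kE; nra.
  have k3 : k.+1%:R <= k.+1%:R ^+ 2 :> R by nra.
  have : (2 * k + 1)%:R ^+ 2 * 4 <= (2 * k + 1)%:R ^+ 2 * pi ^+ 2 :> R.
    by rewrite ler_wpM2l ?sqr_ge0.
  lra.
have small K : exists2 c : R, 0 < c & exists n0, forall n, (n0 <= n)%N ->
    forall k, (k < K)%N -> c * k.+1%:R ^+ 2 <= cmod (gap n k).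
  elim: K => [|K [c c0 [n0 hn0]]]; first by exists 1 => //; exists 0%N.
  have l0 : pi%:C ^+ 2 / 8 * ((2 * K + 1)%:R ^+ 2 - u ^+ 2) != 0.
    by rewrite !mulf_neq0 ?invr_eq0 ?expf_neq0// subr_eq0 eq_sym.
  have [n1 hn1] := ccvg_lower l0 (gap_cvg K).
  move: l0; rewrite -cmod_gt0; move: (cmod _) hn1 => L hn1 L0.
  have K2 : 0 < K.+1%:R ^+ 2 :> R by rewrite exprn_gt0.
  exists (Num.min c (L / 2 / K.+1%:R ^+ 2)).
    by rewrite lt_min c0/= !divr_gt0.
  exists (maxn n0 n1) => n; rewrite geq_max => /andP[nn0 nn1] k.
  rewrite ltnS leq_eqVlt => /predU1P[->|kK].
    rewrite (le_trans _ (hn1 _ nn1))// -ler_pdivlMr// ge_min.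
    by rewrite [X in _ || X]lexx orbT.
  by rewrite (le_trans _ (hn0 _ nn0 _ kK))// ler_wpM2r ?sqr_ge0// ge_min lexx.
have [c c0 [n0 hn0]] := small (Num.Def.trunc (16 * B)).
exists (Num.min c (1 / 16)); first by rewrite lt_min c0/=; lra.
exists n0 => n nn0 k kn.
have [Bk|kB] := leqP (Num.Def.trunc (16 * B)) k.
  by rewrite (le_trans _ (large _ _ Bk kn))// ler_wpM2r ?sqr_ge0// ge_min lexx orbT.
by rewrite (le_trans _ (hn0 _ nn0 _ kB))// ler_wpM2r ?sqr_ge0// ge_min lexx.
Qed.

(** This is the factor that turns [sin (m phi) / (sin phi cos (N phi))] into [sin_over_zcos]; at
    [u = 0] it is given its limit. *)
Let scale n : R[i] := if u == 0 then (pi / 2)%:C else n.+1%:R * csin (phi n) / u.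

Lemma scale_cvg : ccvg scale (pi / 2)%:C.
Proof.
rewrite /scale; have [_|u0] := eqVneq u 0; first exact: ccvg_cst.
have := ccvgM (csin_linear_cvg (pi%:C * u / 2)) (ccvg_cst u^-1).
rewrite [X in ccvg _ X](_ : _ = (pi / 2)%:C); first exact.
by rewrite !rmorphM /= fmorphV /= rmorph_nat; field.
Qed.

(** An exact finite form of the expansion, at angles that are multiples of [pi / (2N)], obtained
    from [node_sumE]. *)
Lemma finite_expansion : exists n0, forall n, (n0 <= n)%N ->
  forall m, (m <= n.+1)%N ->
  \sum_(k < n.+1) scale n * ((-1) ^+ k * sin (m%:R * node R n k))%:C / gap n k =
  sin_over_zcos (m%:R * (pi / (2 * n.+1%:R))) 1 u.
Proof.
have [c c0 [n0 hn0]] := gap_lower.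
have nodeN n : (n0 <= n)%N -> forall k, (k < n.+1)%N ->
    ccos (phi n) != (cos (node R n k))%:C.
  move=> nn0 k kn; rewrite -subr_eq0; have := hn0 n nn0 k kn.
  apply: contraTneq; rewrite /gap => ->; rewrite mulr0 cmod0 -ltNge.
  by rewrite mulr_gt0// exprn_gt0.
have sumE n m : \sum_(k < n.+1) scale n * ((-1) ^+ k * sin (m%:R * node R n k))%:C / gap n k =
    scale n / n.+1%:R ^+ 2 * node_sum n (phi n) m.
  rewrite /node_sum mulr_sumr; apply: eq_bigr => k _.
  by rewrite /gap invfM; ring.
have nC (n : nat) : (n.+1%:R : R[i]) != 0 by rewrite pnatr_eq0.
(* When [u = 0] all [sin (m phi)] vanish; the recurrence becomes [V m.+2 = 2 V m.+1 - V m], solved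
   by [V m = m]. *)
have [u0|u0] := eqVneq u 0.
  exists n0 => n nn0 m mn; rewrite sumE /sin_over_zcos /scale u0 eqxx.
  have phi0 : ccos (phi n) = 1.
    by rewrite /phi u0 mulr0 !mul0r -(rmorph0 (real_complex R)) (csin_ccos_real _).2 cos0.
  have := @node_sumE _ n _ (nodeN n nn0) (fun m => m%:R) erefl (oner_neq0 _) _ m mn.
  rewrite phi0 mulr1 mul1r -natrB// subSnn mulr1 => ->; last first.
    by move=> j; rewrite -!natr1; ring.
  rewrite invr1 mulr1 -[n.+1%:R](rmorph_nat (real_complex R)) -[m%:R](rmorph_nat (real_complex R)).
  rewrite -!(rmorphXn, fmorphV, rmorphM) /=; congr _%:C.
  have : (n.+1%:R : R) != 0 by rewrite pnatr_eq0.
  by move: (n.+1%:R : R) => d d0; field.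
have l0 : pi%:C * u / 2 != 0 by rewrite !mulf_neq0.
have [n1 hn1] := ccvg_lower l0 (csin_linear_cvg _).
exists (maxn n0 n1) => n; rewrite geq_max => /andP[nn0 nn1] m mn.
rewrite sumE /sin_over_zcos /scale (negbTE u0).
have s0 : csin (phi n) != 0.
  have := hn1 n nn1; apply: contraTneq => e; rewrite -/(phi n) e mulr0 cmod0 -ltNge.
  by rewrite divr_gt0// cmod_gt0.
have Vrec j : csin (j.+2%:R * phi n) =
    2 * ccos (phi n) * csin (j.+1%:R * phi n) - csin (j%:R * phi n).
  rewrite (_ : j.+2%:R * _ = j.+1%:R * phi n + phi n); last by ring.
  rewrite (_ : j%:R * _ = j.+1%:R * phi n - phi n); last by ring.
  by rewrite -csinDB addrK.
have topE : ccos (phi n) * csin (n.+1%:R * phi n) - csin (n%:R * phi n) =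
    csin (phi n) * ccos (pi%:C * u / 2).
  rewrite (_ : n%:R * _ = n.+1%:R * phi n - phi n); last by ring.
  rewrite (csin_ccosD _ (- _)).1 csinN ccosN.
  rewrite (_ : pi%:C * u / 2 = n.+1%:R * phi n); last by rewrite /phi; field.
  by ring.
have V0 : csin (0%:R * phi n) = 0 by rewrite mul0r csin0.
have V1 : csin (1%:R * phi n) != 0 by rewrite mul1r.
have key := @node_sumE _ n _ (nodeN n nn0) (fun m => csin (m%:R * phi n)) V0 V1 Vrec.
have := key 1%N isT; rewrite topE => key1.
(* At [m = 1] the right side of [node_sumE] is nonzero, hence so is this factor of the left side. *)
have C0 : ccos (pi%:C * u / 2) != 0.
  have : n.+1%:R * csin (1%:R * phi n) != 0 by rewrite mulf_neq0.
  by rewrite -key1; apply: contraNneq => ->; rewrite !mulr0.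
have := key m mn; rewrite topE => keym.
rewrite divr1 (mulr1 2).
rewrite (_ : (m%:R * _)%:C * u = m%:R * phi n); last first.
  rewrite rmorphM rmorphM /= fmorphV /= rmorphM !rmorph_nat /phi.
  by move: (nC n); move: n.+1%:R => d d0; field.
rewrite (_ : csin (m%:R * phi n) = node_sum n (phi n) m *
   (csin (phi n) * ccos (pi%:C * u / 2)) / n.+1%:R); last first.
  by rewrite keym mulrAC mulfV// mul1r.
by move: (nC n); move: n.+1%:R => d d0; field; rewrite d0 u0 C0.
Qed.

(** The angle is approximated from below by angles [th n] at which the finite expansion is exact;
    [tannery] then passes to the limit. *)
Lemma sin_over_zcos_expansion_ge0 (theta : R) : 0 <= theta <= pi / 2 ->
  csum (fun k => (4 / pi * ((-1) ^+ k * sin ((2 * k + 1)%:R * theta)))%:C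
                 / ((2 * k + 1)%:R ^+ 2 - u ^+ 2))
       (sin_over_zcos theta 1 u).
Proof.
move=> /andP[th0 th2].
(* Rounding down makes the error at most [pi / (2N)], and [theta <= pi / 2] gives [m n <= n.+1], the
   range of the finite expansion. *)
pose m n := Num.Def.trunc (2 * n.+1%:R * theta / pi).
pose th n : R := (m n)%:R * (pi / (2 * n.+1%:R)).
have N0 n : 0 < n.+1%:R :> R by rewrite ltr0n.
have x0 n : 0 <= 2 * n.+1%:R * theta / pi.
  by rewrite divr_ge0 ?(ltW pi0)// mulr_ge0.
have pN0 n : 0 <= pi / (2 * n.+1%:R) :> R by rewrite divr_ge0 ?(ltW pi0)// mulr_ge0.
have mn n : (m n <= n.+1)%N.
  rewrite -(ler_nat R) (@le_trans _ _ (2 * n.+1%:R * theta / pi))//.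
    by rewrite truncn_le.
  rewrite ler_pdivrMr//; have := N0 n; nra.
have thE n : theta = 2 * n.+1%:R * theta / pi * (pi / (2 * n.+1%:R)).
  have := N0 n; move: n.+1%:R => d d0.
  have := pi0; move: (pi : R) => q q0; field.
  by rewrite (gt_eqF d0) (gt_eqF q0).
have th_cvg : th @ \oo --> theta.
  apply/cvgrPdist_le => e e0; have [M _ hM] : \forall n \near \oo, harmonic n <= e / pi :> R.
    have /cvgrPdist_le /(_ (e / pi))[|M _ hM] := @cvg_harmonic R; first by rewrite divr_gt0.
    exists M => // n /hM; rewrite sub0r normrN ger0_norm ?harmonic_ge0//.
  exists M => // n /hM; rewrite /harmonic /= => he.
  have /andP[t1 t2] := truncn_itv (x0 n).
  rewrite [X in X - _](thE n) /th -/(m n) -mulrBl.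
  rewrite ger0_norm; last first.
    by rewrite mulr_ge0 ?subr_ge0.
  apply: (@le_trans _ _ (1 * (pi / (2 * n.+1%:R)))).
    rewrite ler_wpM2r// lerBlDl.
    by rewrite natr1 ltW.
  have he' : n.+1%:R^-1 * pi <= e by rewrite -ler_pdivlMr.
  rewrite mul1r (_ : pi / _ = n.+1%:R^-1 * pi / 2).
    have : 0 <= n.+1%:R^-1 * pi :> R by rewrite mulr_ge0 ?(ltW pi0).
    by move: he'; move: (n.+1%:R^-1 * pi : R) => v; lra.
  by move: (N0 n) (pi : R) => + q; move: n.+1%:R => d d0; field; rewrite (gt_eqF d0).
have [c c0 [n0 hn0]] := gap_lower.
have [n1 hn1] := finite_expansion.
have [D D0 hD] := ccvg_bounded scale_cvg.
(* Extension by zero turns the finite sums into series over all [k]. The later shift by [N1] is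
   there because the lower bound and the finite expansion hold only for large [n]. *)
pose f n k : R[i] := if (k < n.+1)%N then
  scale n * ((-1) ^+ k * sin ((2 * k + 1)%:R * th n))%:C / gap n k else 0.
pose s n := sin_over_zcos (th n) 1 u.
have s_cvg : ccvg s (sin_over_zcos theta 1 u).
  rewrite /s /sin_over_zcos; have [_|u0] := eqVneq u 0.
    exact: ccvgM (ccvg_real th_cvg) (ccvg_cst _).
  have := ccvgM (csin_continuous_real u th_cvg)
    (ccvg_cst (u * ccos (pi%:C * u / (2 * 1)))^-1).
  rewrite divr1; apply: (ccvg_near (N := 0%N)) => n _.
  by rewrite divr1.
pose N1 := maxn n0 n1.
(* The constant is the limit of [scale] over that in [gap]: [(pi / 2) / (pi^2 / 8) = 4 / pi]. *)
have f_cvg k : ccvg (fun n => f (n + N1)%N k)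
    ((4 / pi * ((-1) ^+ k * sin ((2 * k + 1)%:R * theta)))%:C
                 / ((2 * k + 1)%:R ^+ 2 - u ^+ 2)).
  apply: (@ccvg_shift _ (f^~ k)).
  have sk : ccvg (fun n => ((-1) ^+ k * sin ((2 * k + 1)%:R * th n))%:C)
     ((-1) ^+ k * sin ((2 * k + 1)%:R * theta))%:C.
    apply: ccvg_real; apply: cvgMr.
    apply: (@continuous_cvg _ _ _ _ _ _ sin); first exact: continuous_sin.
    exact: cvgMr.
  have l0 : pi%:C ^+ 2 / 8 * ((2 * k + 1)%:R ^+ 2 - u ^+ 2) != 0.
    by rewrite !mulf_neq0 ?invr_eq0 ?expf_neq0// subr_eq0 eq_sym.
  have := ccvgM (ccvgM scale_cvg sk) (ccvgV l0 (gap_cvg k)).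
  rewrite [X in ccvg _ X](_ : _ = (4 / pi * ((-1) ^+ k * sin ((2 * k + 1)%:R * theta)))%:C
                 / ((2 * k + 1)%:R ^+ 2 - u ^+ 2)); last first.
    have -> (S : R) : (4 / pi * S)%:C = 4 / pi%:C * S%:C.
      by rewrite 2!rmorphM /= fmorphV /= rmorph_nat.
    have -> : (pi / 2)%:C = pi%:C / 2 :> R[i] by rewrite rmorphM /= fmorphV /= rmorph_nat.
    have := u_odd k; rewrite -subr_eq0 -oppr_eq0 opprB.
    by move: (_ - _) (_%:C) piC0 => d v p0 d0; field; rewrite p0 d0.
  apply: (ccvg_near (N := k)) => n kn; rewrite /f ltnS kn.
  by [].
have fb n k : cmod (f (n + N1)%N k) <= D / c * (k.+1%:R ^+ 2)^-1.
  rewrite /f; case: ifP => kn; last first.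
    by rewrite cmod0 !mulr_ge0 ?invr_ge0 ?sqr_ge0 ?ltW.
  have := hn0 (n + N1)%N (leq_trans (leq_maxl _ _) (leq_addl _ _)) k kn.
  have := hD (n + N1)%N; move: (gap _ k) (scale _) => G S hS hG.
  rewrite !cmodM cmodV.
  have k2 : 0 < k.+1%:R ^+ 2 :> R by rewrite exprn_gt0.
  rewrite -[leRHS]mulrA -invfM ler_pM ?mulr_ge0 ?invr_ge0 ?cmod_ge0//.
    rewrite -[leRHS]mulr1 ler_pM ?cmod_ge0//.
    by rewrite cmodR normrM normrX normrN1 expr1n mul1r sin_max.
  rewrite lef_pV2// posrE ?mulr_gt0//.
  by rewrite (lt_le_trans _ hG)// mulr_gt0.
have bB n : \sum_(k < n) D / c * (k.+1%:R ^+ 2)^-1 <= D / c * 2.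
  by rewrite -mulr_sumr ler_wpM2l ?sum_inv_sqr_le2// divr_ge0 ?ltW.
have fs n : csum (f (n + N1)%N) (s (n + N1)%N).
  apply: (ccvg_near (N := (n + N1).+1)) (ccvg_cst _) => j nj /=.
  rewrite /s /th -hn1 ?mn//; last first.
    by rewrite (leq_trans (leq_maxr n0 _)) ?leq_addl.
  rewrite (big_ord_widen j (fun k => scale (n + N1) * ((-1) ^+ k *
    sin ((m (n + N1)%N)%:R * node R (n + N1) k))%:C / gap (n + N1) k))//.
  rewrite big_mkcond; apply: eq_bigr => k _; rewrite /f; case: ifP => // _.
  by rewrite /th /node mulrCA.
have [l gl sl] := tannery f_cvg fb bB fs.
by rewrite (ccvg_unique (ccvg_shift N1 s_cvg) sl).
Qed.

End Expansion.

(** * Products of abstract simple-pole expansions *)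

Section MittagLefflerProduct.
Variables (R : realType) (I : eqType).
Variables (A p : I -> nat -> R[i]) (F : I -> R[i] -> R[i]).

Definition regular i (w : R[i]) := forall k, p i k != w.

Hypothesis F_csum : forall i w, regular i w ->
  csum (fun k => A i k / (p i k - w)) (F i w).
Hypothesis A_bounded : forall i, exists B : R, forall k, cmod (A i k) <= B.
Hypothesis F_summable : forall i w, regular i w ->
  abs_summable (fun k => A i k / (p i k - w)).
Hypothesis p_separated : forall i j, i != j -> forall n, regular j (p i n).
Hypothesis F_uniform : forall i j, i != j ->
  exists B : R, forall n N,
  \sum_(k < N) cmod (A j k / (p j k - p i n)) <= B.
Hypothesis inv_uniform : forall i j, i != j ->
  exists B : R, forall n N,
  \sum_(k < N) (cmod (p j k - p i n))^-1 <= B.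

(** For simple poles and a duplicate-free [s] containing [i], [- A i n] times this is the residue at
    [p i n] of the product over [s]. *)
Definition residue_factor (s : seq I) i n := \prod_(j <- s | j != i) F j (p i n).

(** By [F_uniform] the partial sums of [F j] at the points [p i n] are bounded uniformly in [n], and
    the bound passes to their limits. *)
Lemma residue_factor_bounded s i :
  exists B : R, forall n, cmod (residue_factor s i n) <= B.
Proof.
rewrite /residue_factor; elim: s => [|j s [B IH]].
  by exists (cmod 1) => n; rewrite big_nil.
have B0 : 0 <= B by rewrite (le_trans (cmod_ge0 _) (IH 0%N)).
have [ji|ji] := boolP (j != i); last first.
  by exists B => n; rewrite big_cons (negbTE ji).
have [D FD] := F_uniform (i := i) (j := j) ltac:(by rewrite eq_sym).
exists (D * B) => n; rewrite big_cons ji cmodM ler_pM ?cmod_ge0//.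
have reg : regular j (p i n) by apply: p_separated; rewrite eq_sym.
apply: (cmod_le_ccvg (F_csum reg)) => N.
by rewrite (le_trans (cmod_sum _ _ _)).
Qed.

Lemma term_bounded s i :
  exists B : R, forall n, cmod (A i n * residue_factor s i n) <= B.
Proof.
have [B hB] := A_bounded i; have [D hD] := residue_factor_bounded s i.
by exists (B * D) => n; rewrite cmodM ler_pM ?cmod_ge0.
Qed.

Lemma term_summable s i w : regular i w ->
  abs_summable (fun n => A i n / (p i n - w) * residue_factor s i n).
Proof.
move=> reg; have [B hB] := F_summable reg; have [D hD] := residue_factor_bounded s i.
exists (B * D) => N.
have D0 : 0 <= D by rewrite (le_trans (cmod_ge0 _) (hD 0%N)).
apply: (@le_trans _ _ (\sum_(k < N) cmod (A i k / (p i k - w)) * D)).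
  by apply: ler_sum => k _; rewrite cmodM ler_wpM2l ?cmod_ge0.
by rewrite -mulr_suml ler_wpM2r.
Qed.

Lemma residue_factor_cons s m i n : m != i ->
  residue_factor (m :: s) i n = F m (p i n) * residue_factor s i n.
Proof. by move=> mi; rewrite /residue_factor big_cons mi. Qed.

Lemma residue_factor_head s m n : m \notin s ->
  residue_factor (m :: s) m n = \prod_(j <- s) F j (p m n).
Proof.
move=> ms; rewrite /residue_factor big_cons eqxx /=.
rewrite big_seq_cond [RHS]big_seq; apply: eq_bigl => j.
have [js|//] := boolP (j \in s); rewrite /=.
by apply: contraNneq ms => <-.
Qed.

(* Multiplying by a further factor [F m], the product of two simple poles splits as
   [1/((p-w)(q-w)) = (1/(p-w) - 1/(q-w)) / (q-p)]; the resulting double series converges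
   absolutely, so its order of summation can be exchanged, and the inner sum
   is the induction hypothesis at the point [w = p m k]. *)
Lemma csum_prod (s : seq I) (w : R[i]) : s != [::] -> uniq s ->
  (forall i, i \in s -> regular i w) ->
  csum (fun n => \sum_(i <- s) A i n / (p i n - w) * residue_factor s i n)
       (\prod_(i <- s) F i w).
Proof.
case: s => // m s _; elim: s m w => [|m' s IH] m w.
  move=> _ reg; rewrite big_seq1.
  apply: eq_csum (F_csum (reg m _)); last by rewrite mem_head.
  by move=> k; rewrite big_seq1 /residue_factor big_cons big_nil eqxx /= mulr1.
set s' := m' :: s; move=> /andP[ms' us'] reg.
have regs i : i \in s' -> regular i w by move=> si; apply: reg; rewrite inE si orbT.
have regm : regular m w by apply: reg; rewrite mem_head.
have mi i : i \in s' -> i != m by apply: contraTneq => ->.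
(* Row [k] is summed by the induction hypothesis at [p m k]; column [n] splits into the expansions
   of [F m] at [p i n] and at [w]. *)
pose c k n := A m k / (p m k - w) *
  \sum_(i <- s') A i n * residue_factor s' i n / (p m k - p i n).
have Fm k : csum (fun n => \sum_(i <- s') A i n / (p i n - p m k) * residue_factor s' i n)
    (\prod_(i <- s') F i (p m k)).
  by apply: IH => // i si; apply: p_separated; rewrite eq_sym mi.
have crow k : csum (c k) (- (A m k / (p m k - w) * residue_factor (m :: s') m k)).
  rewrite residue_factor_head// -mulrN -mulN1r.
  have := csumZ (A m k / (p m k - w)) (csumZ (-1) (Fm k)).
  apply: eq_csum => n; rewrite /c; congr (_ * _); rewrite mulr_sumr.
  apply: eq_bigr => i _; rewrite -(opprB (p m k)) invrN; ring.
have ccol n : csum (c^~ n) (\sum_(i <- s')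
    (A i n / (p i n - w) * residue_factor (m :: s') i n
     - F m w * (A i n / (p i n - w) * residue_factor s' i n))).
  have inner i : i \in s' ->
      csum (fun k => A i n * residue_factor s' i n *
                     (A m k / ((p m k - w) * (p m k - p i n))))
      (A i n / (p i n - w) * residue_factor (m :: s') i n
       - F m w * (A i n / (p i n - w) * residue_factor s' i n)).
    move=> si; have im := mi _ si; have regmi := p_separated im n.
    have h1 := csumZ (A i n * residue_factor s' i n / (p i n - w)) (F_csum regmi).
    have h2 := csumZ (- (A i n * residue_factor s' i n / (p i n - w))) (F_csum regm).
    have := csumD h1 h2.
    rewrite (_ : _ * F m (p i n) + _ = A i n / (p i n - w) * residue_factor (m :: s') i n
       - F m w * (A i n / (p i n - w) * residue_factor s' i n)); last first.
      by rewrite residue_factor_cons; [ring|rewrite eq_sym].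
    apply: eq_csum => k.
    have n1 : p m k - w != 0 by rewrite subr_eq0; exact: regm.
    have n2 : p i n - w != 0 by rewrite subr_eq0; exact: regs.
    have n3 : p m k - p i n != 0 by rewrite subr_eq0; exact: regmi.
    by field; rewrite n1 n2 n3.
  rewrite big_seq; have := @csum_sum _ _ s' (fun i => i \in s') _ _ inner.
  apply: eq_csum => k; rewrite /c mulr_sumr [RHS]big_seq; apply: eq_bigr => i _.
  by rewrite invfM; ring.
have [D hD] : exists D : R, forall k N,
    \sum_(n < N) cmod (\sum_(i <- s') A i n * residue_factor s' i n / (p m k - p i n)) <= D.
  (* Only the list summed over shrinks in this induction; the list [t] inside [residue_factor] stays
     fixed. *)
  move: (s') {1 2}(s') mi => t; elim=> [|i r IHr] rm.
    by exists 0 => k N; rewrite big1// => n _; rewrite big_nil cmod0.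
  have [|D hD] := IHr; first by move=> j jr; apply: rm; rewrite inE jr orbT.
  have im : i != m by apply: rm; rewrite mem_head.
  have [B hB] := term_bounded t i.
  have [E hE] := inv_uniform (i := m) (j := i) ltac:(by rewrite eq_sym).
  have B0 : 0 <= B by rewrite (le_trans (cmod_ge0 _) (hB 0%N)).
  exists (B * E + D) => k N.
  rewrite (le_trans _ (lerD (ler_wpM2l B0 (hE k N)) (hD k N)))//.
  rewrite mulr_sumr -big_split ler_sum//= => n _.
  rewrite big_cons (le_trans (cmodD _ _))// lerD2r cmodM cmodV cmodB.
  by rewrite ler_wpM2r ?invr_ge0 ?cmod_ge0.
have D0 : 0 <= D by have := hD 0%N 0%N; rewrite big_ord0.
have [B hB] := F_summable regm.
have [||l rl ql] := @csum_interchange _ c _ _ (fun k => cmod (A m k / (p m k - w)) * D)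
   (B * D) crow ccol.
- move=> k N; rewrite /c; under eq_bigr do rewrite cmodM.
  by rewrite -mulr_sumr ler_wpM2l ?cmod_ge0.
- by move=> N; rewrite -mulr_suml ler_wpM2r.
have hl : csum (fun k => A m k / (p m k - w) * residue_factor (m :: s') m k) (- l).
  have := csumZ (-1) rl; rewrite mulN1r; apply: eq_csum => k.
  by rewrite mulN1r opprK.
have IHw := csumZ (F m w) (IH m' w us' regs).
(* The terms of [m] sum to [- l]. Those of [s'] are the column sums, with total [l], plus [F m w]
   times the induction hypothesis; the two [l] cancel. *)
have := csumD hl (csumD ql IHw); rewrite addKr [X in _ -> csum _ X]big_cons.
apply: eq_csum => n; rewrite [RHS]big_cons; congr (_ + _).
by rewrite mulr_sumr -big_split /=; apply: eq_bigr => i _; rewrite subrK.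
Qed.

End MittagLefflerProduct.

(** * Lower bounds for the distances between poles *)

Section PoleSeparation.
Variable R : realType.

(** Finitely many exceptional points only cost a smaller constant, since [g t / h t] is positive at
    each of them. *)
Lemma lower_bound_extend (T : eqType) (s : seq T) (g h : T -> R) (c : R) :
  0 < c -> (forall t, 0 < g t) -> (forall t, 0 < h t) ->
  (forall t, t \notin s -> c * h t <= g t) ->
  exists2 c', 0 < c' & forall t, c' * h t <= g t.
Proof.
move=> c0 g0 h0; elim: s c c0 => [|a s IH] c c0 hc.
  by exists c => // t; exact: hc.
apply: (IH (Num.min c (g a / h a))); first by rewrite lt_min c0 divr_gt0.
move=> t ts; have [->|ta] := eqVneq t a.
  by rewrite -ler_pdivlMr// ge_min lexx orbT.
rewrite (le_trans _ (hc t _)) ?inE ?negb_or ?ta//.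
by rewrite (ler_wpM2r (ltW (h0 t)))// ge_min lexx.
Qed.

Definition dist2 (k n : nat) : R := 1 + (k%:R - n%:R) ^+ 2.

(** Cut at [k = n]: the terms below the diagonal, read backwards, give at most [2]; the diagonal
    term and those above give at most [1 + 2]. *)
Lemma sum_inv_dist2 n N : \sum_(k < N) (dist2 k n)^-1 <= 5.
Proof.
have d0 k : 0 < (dist2 k n)^-1 by rewrite invr_gt0 ltr_pwDl ?sqr_ge0.
have far m : \sum_(k < m) (1 + k%:R ^+ 2)^-1 <= 3 :> R.
  case: m => [|m]; first by rewrite big_ord0.
  rewrite big_ord_recl /= expr0n addr0 invr1.
  apply: (@le_trans _ _ (1 + 2)); last by lra.
  rewrite lerD2l (le_trans _ (sum_inv_sqr_le2 R m))// ler_sum// => k _.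
  rewrite lef_pV2 ?posrE ?exprn_gt0// ?ltr_pwDl ?sqr_ge0//.
  by rewrite lerDr.
have N_le : (N <= n + N)%N by rewrite leq_addl.
apply: (@le_trans _ _ (\sum_(k < n + N) (dist2 k n)^-1)).
  rewrite (big_ord_widen _ (fun k => (dist2 k n)^-1) N_le) big_mkcond ler_sum// => k _.
  by case: ifP => // _; exact: ltW.
rewrite big_split_ord /= (_ : 5 = 2 + 3); last by lra.
apply: lerD; last first.
  apply: le_trans (far N); rewrite ler_sum// => k _.
  by rewrite /dist2 natrD [n%:R + _]addrC addrK.
apply: (le_trans _ (sum_inv_sqr_le2 R n)).
rewrite (reindex_inj rev_ord_inj) /= ler_sum// => k _.
rewrite lef_pV2 ?posrE ?exprn_gt0//; last by rewrite -invr_gt0.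
rewrite /dist2 natrB; last by have := ltn_ord k; lia.
rewrite addrAC subrr add0r sqrrN lerDr ler01 //.
Qed.

(** Past the threshold [2 |d| / |x|^2], the shift [d] takes away at most half of the leading
    term. *)
Lemma quadratic_growth (x d : R[i]) : x != 0 ->
  (forall k : nat, x ^+ 2 * (2 * k + 1)%:R ^+ 2 + d != 0) ->
  exists2 c : R, 0 < c & forall k : nat,
    c * k.+1%:R ^+ 2 <= cmod (x ^+ 2 * (2 * k + 1)%:R ^+ 2 + d).
Proof.
move=> x0 nz; have X0 : 0 < cmod x ^+ 2 by rewrite exprn_gt0// cmod_gt0.
apply: (@lower_bound_extend _ (iota 0 (Num.Def.trunc (2 * cmod d / cmod x ^+ 2)))
    (fun k => cmod (x ^+ 2 * (2 * k + 1)%:R ^+ 2 + d)) (fun k => k.+1%:R ^+ 2)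
    (cmod x ^+ 2 / 2)).
- by rewrite divr_gt0.
- by move=> k; rewrite cmod_gt0.
- by move=> k; rewrite exprn_gt0.
move=> k; rewrite mem_iota add0n leq0n /= -leqNgt => dk.
have : 2 * cmod d / cmod x ^+ 2 < k.+1%:R.
  by rewrite (lt_le_trans (truncnS_gt _))// ler_nat.
rewrite ltr_pdivrMr//.
have := cmodD (x ^+ 2 * (2 * k + 1)%:R ^+ 2 + d) (- d).
rewrite addrK cmodN cmodM !cmodX cmod_nat.
have -> : (2 * k + 1)%:R = 2 * k.+1%:R - 1 :> R by rewrite natrD natrM -natr1; ring.
have k1 : 1 <= k.+1%:R :> R by rewrite ler1n.
move: (cmod x ^+ 2) (cmod (_ + d)) (cmod d) X0 k1 => X S D X0.
move: (k.+1%:R : R) => K k1 h1 h2.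
have h3 : K <= K ^+ 2 by nra.
have h4 : K ^+ 2 <= (2 * K - 1) ^+ 2 by nra.
have h5 := ler_wpM2l (ltW X0) h3; have h6 := ler_wpM2l (ltW X0) h4.
lra.
Qed.

(** With [K = 2k+1], [N = 2n+1] and [r = x / y], the difference is [y^2 (K - rN)(K + rN) + (b - a)].
    If [r] is not real, both factors are at least a multiple of [K + N]. If [r = 1], then
    [|K - N| >= 2] off the diagonal, and on it only [b - a], nonzero by hypothesis, remains. The
    shift [b - a] is absorbed when [k + n] is large. *)
Lemma pole_separation (x y a b : R[i]) : y != 0 ->
  complex.Im (x / y) != 0 \/ x = y ->
  (forall k n : nat, y ^+ 2 * (2 * k + 1)%:R ^+ 2 + b !=
                     x ^+ 2 * (2 * n + 1)%:R ^+ 2 + a) ->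
  exists2 c : R, 0 < c & forall k n : nat, c * dist2 k n <=
    cmod (y ^+ 2 * (2 * k + 1)%:R ^+ 2 + b - (x ^+ 2 * (2 * n + 1)%:R ^+ 2 + a)).
Proof.
move=> y0 hxy nz.
pose g (t : nat * nat) := cmod (y ^+ 2 * (2 * t.1 + 1)%:R ^+ 2 + b
  - (x ^+ 2 * (2 * t.2 + 1)%:R ^+ 2 + a)).
suff [c c0 [L hL]] : exists2 c : R, 0 < c & exists L : nat, forall k n : nat,
    (L <= k + n)%N -> c * dist2 k n <= g (k, n).
  have [|||c' c'0 hc'] := @lower_bound_extend _
      [seq (k, n) | k <- iota 0 L, n <- iota 0 L] g (fun t => dist2 t.1 t.2) c c0.
  - by move=> t; rewrite cmod_gt0 subr_eq0.
  - by move=> t; rewrite ltr_pwDl ?sqr_ge0.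
  - case=> k n kns; apply: hL; rewrite leqNgt; apply: contra kns => knL.
    have kL := leq_ltn_trans (leq_addr n k) knL.
    have nL := leq_ltn_trans (leq_addl k n) knL.
    by apply/allpairsP; exists (k, n); rewrite !mem_iota /= kL nL.
  by exists c' => // k n; exact: (hc' (k, n)).
set Y := cmod y ^+ 2; have Y0 : 0 < Y by rewrite exprn_gt0// cmod_gt0.
set d := cmod (b - a); have d0 : 0 <= d by exact: cmod_ge0.
set r := x / y in hxy.
have gE k n : Y * (cmod ((2 * k + 1)%:R - r * (2 * n + 1)%:R) *
    cmod ((2 * k + 1)%:R + r * (2 * n + 1)%:R)) <= g (k, n) + d.
  rewrite -cmodM /Y -cmodX -cmodM.
  have := cmodD (y ^+ 2 * (2 * k + 1)%:R ^+ 2 + b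
    - (x ^+ 2 * (2 * n + 1)%:R ^+ 2 + a)) (- (b - a)).
  rewrite cmodN -/d; apply: le_trans; rewrite le_eqVlt; apply/orP; left.
  by apply/eqP; congr cmod; rewrite /r; field.
have odd1 k : (1 <= (2 * k + 1)%:R :> R) by rewrite ler1n addn1.
have oddE j : (2 * j + 1)%:R = 2 * j%:R + 1 :> R by rewrite natrD natrM.
have distE k n : dist2 k n = 1 + ((2 * k + 1)%:R - (2 * n + 1)%:R) ^+ 2 / 4.
  by rewrite /dist2 !oddE; field.
have sumE k n : k%:R + n%:R <= (2 * k + 1)%:R + (2 * n + 1)%:R :> R.
  by rewrite -!natrD ler_nat; lia.
have [r_im|rxy] := hxy; last first.
  have d1 : 0 < d.
    rewrite cmod_gt0; have := nz 0%N 0%N; rewrite rxy; apply: contraNneq => e.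
    by rewrite -subr_eq0 opprD addrACA subrr add0r e.
  exists (Num.min Y d); first by rewrite lt_min Y0.
  (* Off the diagonal this makes [d] at most a quarter of [Y |K - N| (K + N)]. *)
  exists (Num.Def.trunc (2 * d / Y)).+1 => k n knL.
  have [->|kn] := eqVneq k n.
    rewrite distE subrr expr0n /= mul0r addr0 mulr1 /g /= rxy.
    rewrite opprD addrACA subrr add0r ge_min; apply/orP; right.
    exact: lexx.
  have hL : 2 * d < (k%:R + n%:R) * Y.
    rewrite -ltr_pdivrMr// (lt_le_trans (truncnS_gt _))//.
    by rewrite -natrD ler_nat.
  have := gE k n; rewrite /r rxy divff// !mul1r -!real_complex_nat -rmorphB -rmorphD !cmodR.
  set K : R := (2 * k + 1)%:R; set N : R := (2 * n + 1)%:R => hg.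
  have K1 : 1 <= K := odd1 k; have N1 : 1 <= N := odd1 n.
  have KN : 2 <= `|K - N|.
    have -> : K - N = 2 * (k%:R - n%:R) by rewrite /K /N !oddE; ring.
    rewrite normrM ger0_norm// ler_peMr//.
    move: kn; rewrite neq_ltn ler_normr => /orP[] h; apply/orP; [right|left].
      have : k%:R + 1 <= n%:R :> R by rewrite natr1 ler_nat.
      by lra.
    have : n%:R + 1 <= k%:R :> R by rewrite natr1 ler_nat.
    by lra.
  have KN' : `|K - N| <= K + N by rewrite ler_norml; lra.
  move: hg; rewrite (ger0_norm (_ : 0 <= K + N)); last by lra.
  have := sumE k n; rewrite -/K -/N => sumKN.
  rewrite distE -/K -/N -[(K - N) ^+ 2]real_normK ?num_real//.
  move: (`|K - N|) KN KN' => Z Z2 ZKN hg.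
  have h1 : Z * Z <= Z * (K + N) by rewrite ler_wpM2l//; lra.
  have h2 : 2 * (K + N) <= Z * (K + N) by rewrite ler_wpM2r//; lra.
  have h3 := ler_wpM2l (ltW Y0) h1; have h4 := ler_wpM2l (ltW Y0) h2.
  have h5 := ler_wpM2l (ltW Y0) sumKN.
  have h6 : 2 * 2 <= Z * Z by rewrite ler_pM.
  have h7 := ler_wpM2l (ltW Y0) h6.
  apply: (@le_trans _ _ (Y * (1 + Z ^+ 2 / 4))).
    rewrite ler_wpM2r ?ge_min ?lexx//; nra.
  lra.
set m := `|complex.Im r|; have m0 : 0 < m by rewrite normr_gt0.
(* For [Z = K + e r N] with [e] equal to [1] or [-1], the imaginary part gives [N <= |Z| / m], hence
   [K <= |Z| + |r| N <= (1 + |r| / m) |Z|]; adding the two gives [q]. *)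
set q := 1 + cmod r / m + m^-1.
have q0 : 0 < q by rewrite !ltr_pwDl ?invr_ge0 ?divr_ge0 ?cmod_ge0 ?ltW.
have factor (e : R) k n : `|e| = 1 -> (2 * k + 1)%:R + (2 * n + 1)%:R <=
    q * cmod ((2 * k + 1)%:R + (e%:C * r) * (2 * n + 1)%:R).
  move=> e1; set Z := _ + _ * _.
  have ZI : m * (2 * n + 1)%:R <= cmod Z.
    rewrite (le_trans _ (Im_le_cmod Z))// /Z -!real_complex_nat.
    rewrite (_ : complex.Im _ = e * complex.Im r * (2 * n + 1)%:R).
      by rewrite !normrM e1 mul1r normr_nat.
    by case: (r) => c s /=; ring.
  have ZR : (2 * k + 1)%:R <= cmod Z + cmod r * (2 * n + 1)%:R.
    have := cmodD Z (- ((e%:C * r) * (2 * n + 1)%:R)).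
    by rewrite addrK cmodN !cmodM cmodR e1 mul1r !cmod_nat.
  have nZ : (2 * n + 1)%:R <= m^-1 * cmod Z by rewrite ler_pdivlMl.
  have := ler_wpM2l (cmod_ge0 r) nZ; rewrite /q; lra.
have q2 : 0 < q ^+ 2 by rewrite exprn_gt0.
pose c1 := Y / q ^+ 2; have c10 : 0 < c1 by rewrite divr_gt0.
exists c1 => //.
(* Then [d] is at most half of [c1 (K + N)^2], and the other half dominates [c1 * dist2 k n]. *)
exists (Num.Def.trunc (2 * d / c1)).+1 => k n knL.
have hL : 2 * d < (k%:R + n%:R) * c1.
  rewrite -ltr_pdivrMr// (lt_le_trans (truncnS_gt _))//.
  by rewrite -natrD ler_nat.
have := factor 1 k n (normr1 _); have := factor (- 1) k n (normrN1 _).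
rewrite rmorphN rmorph1 mulN1r mul1r mulNr.
have := gE k n; have := sumE k n; rewrite distE.
have K1 := odd1 k; have N1 := odd1 n.
move: (cmod ((2 * k + 1)%:R - r * (2 * n + 1)%:R))
  (cmod ((2 * k + 1)%:R + r * (2 * n + 1)%:R)) => Z1 Z2.
move: ((2 * k + 1)%:R : R) ((2 * n + 1)%:R : R) K1 N1 => K N K1 N1 sumKN hg f1 f2.
have s0 : 0 <= K + N by lra.
have h1 : (K + N) * (K + N) <= q * Z1 * (q * Z2) by rewrite ler_pM.
have h2 : c1 * ((K + N) * (K + N)) <= Y * (Z1 * Z2).
  rewrite (_ : Y * _ = c1 * (q * Z1 * (q * Z2))); first by rewrite (ler_wpM2l (ltW c10)).
  by rewrite /c1; field; rewrite gt_eqF.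
have h3 := ler_wpM2l (ltW c10) sumKN.
have h4 : K + N <= (K + N) * (K + N) by nra.
have h5 := ler_wpM2l (ltW c10) h4.
have h6 : 1 + (K - N) ^+ 2 / 4 <= (K + N) * (K + N) / 2 by nra.
have h7 := ler_wpM2l (ltW c10) h6.
lra.
Qed.

End PoleSeparation.

(** * Expansion of one factor with general parameters *)

Section Assembly.
Variable R : realType.
Implicit Types (theta : R) (x z a w : R[i]).

Lemma sin_over_zcos_scale theta x z : x != 0 ->
  sin_over_zcos theta x z = x^-1 * sin_over_zcos theta 1 (z / x).
Proof.
move=> x0; rewrite /sin_over_zcos mulf_eq0 invr_eq0 (negbTE x0) orbF.
have [_|z0] := eqVneq z 0; first by rewrite divr1 mulrC.
rewrite !divr1 (mulr1 2) -(mulrA _ z).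
rewrite (_ : pi%:C * z / (2 * x) = pi%:C * (z / x) / 2); last by field.
move: (csin _) (ccos _) => S C; rewrite (invfM z C) (invfM _ C).
by move: C^-1 => D; field; rewrite x0 z0.
Qed.

Lemma sin_over_zcos_oppl theta x z :
  sin_over_zcos (- theta) x z = - sin_over_zcos theta x z.
Proof.
rewrite /sin_over_zcos rmorphN /=; case: eqP => _; first by rewrite mulNr.
by rewrite !mulNr csinN mulNr.
Qed.

(** The factor [x] is [x^-1] from rescaling the quotient times [x^2] from clearing the
    denominator. *)
Definition coef theta x (k : nat) : R[i] :=
  (4 / pi)%:C * x * ((-1) ^+ k * sin ((2 * k + 1)%:R * theta))%:C.

(** The case [x = 1] is used at [u = sqrtC (w - a) / x], and oddness in [theta] handles negative
    angles. Here [a] stands for the square [a_j^2]. *)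
Lemma sin_over_zcos_expansion theta x a w : `|theta| <= pi / 2 -> x != 0 ->
  (forall k : nat, x ^+ 2 * (2 * k + 1)%:R ^+ 2 + a != w) ->
  csum (fun k => coef theta x k / (x ^+ 2 * (2 * k + 1)%:R ^+ 2 + a - w))
       (sin_over_zcos theta x (sqrtC (w - a))).
Proof.
move=> + x0 xw; wlog th0 : theta / 0 <= theta.
  move=> wl thpi; have [/wl|th0] := leP 0 theta; first exact.
  have := wl (- theta); rewrite normrN oppr_ge0 => /(_ (ltW th0) thpi) /(csumZ (-1)).
  rewrite sin_over_zcos_oppl mulN1r opprK; apply: eq_csum => k.
  by rewrite mulN1r /coef mulrN sinN mulrN rmorphN /= mulrN mulNr opprK.
rewrite ger0_norm// => thpi.
have u_odd k : (sqrtC (w - a) / x) ^+ 2 != (2 * k + 1)%:R ^+ 2.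
  rewrite expr_div_n sqrtCK; apply: contraNneq (xw k) => <-.
  by rewrite mulrC divfK ?sqrf_eq0// subrK.
have /andP/(sin_over_zcos_expansion_ge0 u_odd) := conj th0 thpi.
move=> /(csumZ x^-1); rewrite -sin_over_zcos_scale//; apply: eq_csum => k.
have := u_odd k; rewrite expr_div_n sqrtCK.
rewrite eq_sym -subr_eq0 => d0; have := xw k; rewrite -subr_eq0 => e0.
rewrite /coef rmorphM /=; move: (_%:C) (_%:C) => P S.
rewrite (_ : _ + a - w = x ^+ 2 * ((2 * k + 1)%:R ^+ 2 - (w - a) / x ^+ 2)).
  move: d0; move: (_ - _) => D d0.
  by field; rewrite x0 d0.
by field.
Qed.

Lemma coef_bounded theta x k : cmod (coef theta x k) <= cmod ((4 / pi)%:C * x).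
Proof.
rewrite /coef cmodM -[leRHS]mulr1 ler_wpM2l ?cmod_ge0//.
by rewrite cmodR normrM normrX normrN1 expr1n mul1r sin_max.
Qed.

End Assembly.

(** * The identity for a product of [M] factors *)

Theorem proposition2 (R : realType) (M : nat) (hM : (1 <= M)%N)
  (theta : 'I_M -> R) (htheta : forall i, `|theta i| <= pi / 2)
  (a x : 'I_M -> R[i]) (hx : forall i, x i != 0)
  (hpoles : forall i j, i != j -> forall n k : nat, odd n -> odd k ->
    x i ^+ 2 * n%:R ^+ 2 - x j ^+ 2 * k%:R ^+ 2 != a j ^+ 2 - a i ^+ 2)
  (hratio : forall i j, i != j ->
    complex.Im (x i / x j) != 0 \/ x i = x j)
  (t : R[i])
  (ht : forall i (n : nat), odd n -> (1 <= n)%N ->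
    t ^+ 2 != a i ^+ 2 + x i ^+ 2 * n%:R ^+ 2) :
  let term (i : 'I_M) : nat -> R[i]^o := fun n =>
    (-1) ^+ n * (sin ((2 * n + 1)%:R * theta i))%:C
      / (x i ^+ 2 * (2 * n + 1)%:R ^+ 2 + a i ^+ 2 - t ^+ 2)
    * \prod_(j < M | j != i)
        sin_over_zcos (theta j) (x j)
          (sqrtC (x i ^+ 2 * (2 * n + 1)%:R ^+ 2 + a i ^+ 2 - a j ^+ 2)) in
  (forall i, cvgn (series (term i))) /\
  \sum_(i < M) x i * limn (series (term i)) =
    (pi / 4)%:C *
    \prod_(i < M) sin_over_zcos (theta i) (x i) (sqrtC (t ^+ 2 - a i ^+ 2)).
Proof.
move=> term.
pose p i n : R[i] := x i ^+ 2 * (2 * n + 1)%:R ^+ 2 + a i ^+ 2.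
pose F i (w : R[i]) := sin_over_zcos (theta i) (x i) (sqrtC (w - a i ^+ 2)).
pose A i n := coef (theta i) (x i) n.
have odd21 k : odd (2 * k + 1) by rewrite oddD oddM.
have F_csum i w : regular p i w -> csum (fun k => A i k / (p i k - w)) (F i w).
  by move=> reg; apply: sin_over_zcos_expansion.
have A_bounded i : exists B : R, forall k, cmod (A i k) <= B.
  by eexists; exact: coef_bounded.
have F_summable i w : regular p i w -> abs_summable (fun k => A i k / (p i k - w)).
  move=> reg; have [|c c0 hc] := quadratic_growth (d := a i ^+ 2 - w) (hx i).
    by move=> k; rewrite addrA subr_eq0; exact: reg.
  exists (cmod ((4 / pi)%:C * x i) / c * 2) => N.
  apply: le_trans (ler_wpM2l _ (sum_inv_sqr_le2 R N)); last first.
    by rewrite divr_ge0 ?cmod_ge0 ?ltW.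
  rewrite mulr_sumr ler_sum// => k _; rewrite cmodM cmodV -mulrA -invfM.
  have k2 : 0 < k.+1%:R ^+ 2 :> R by rewrite exprn_gt0.
  have := hc k; rewrite addrA => {}hc.
  rewrite ler_pM ?invr_ge0 ?cmod_ge0 ?coef_bounded// lef_pV2// posrE ?mulr_gt0//.
  by rewrite (lt_le_trans _ hc)// mulr_gt0.
have p_separated i j : i != j -> forall n, regular p j (p i n).
  move=> ij n k; rewrite eq_sym -subr_eq0; have := hpoles i j ij _ _ (odd21 n) (odd21 k).
  by rewrite -subr_eq0 opprB addrACA -opprD.
(* The alternative on [x i / x j] enters here: separation by [dist2] gives sums bounded
   independently of [n]. *)
have inv_uniform i j : i != j -> exists B : R, forall n N,
    \sum_(k < N) (cmod (p j k - p i n))^-1 <= B.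
  move=> ij; have [|c c0 hc] := @pole_separation _ (x i) (x j) (a i ^+ 2) (a j ^+ 2)
    (hx j) (hratio i j ij).
    by move=> k n; exact: p_separated.
  exists (c^-1 * 5) => n N.
  apply: le_trans (ler_wpM2l _ (sum_inv_dist2 R n N)); last by rewrite invr_ge0 ltW.
  have dist0 k : 0 < dist2 R k n by rewrite ltr_pwDl ?sqr_ge0.
  have pos k : 0 < cmod (p j k - p i n).
    by rewrite (lt_le_trans _ (hc k n))// mulr_gt0.
  rewrite mulr_sumr ler_sum// => k _.
  by rewrite -invfM lef_pV2 ?posrE ?mulr_gt0 ?pos//; exact: hc.
have F_uniform i j : i != j -> exists B : R, forall n N,
    \sum_(k < N) cmod (A j k / (p j k - p i n)) <= B.
  move=> ij; have [B hB] := inv_uniform i j ij.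
  exists (cmod ((4 / pi)%:C * x j) * B) => n N.
  apply: le_trans (ler_wpM2l (cmod_ge0 _) (hB n N)).
  rewrite mulr_sumr ler_sum// => k _.
  by rewrite cmodM cmodV ler_wpM2r ?invr_ge0 ?cmod_ge0 ?coef_bounded.
have reg_t i : regular p i (t ^+ 2).
  move=> k; have := ht i _ (odd21 k); rewrite addn1 => /(_ isT).
  by rewrite eq_sym addrC /p addn1.
pose s := index_enum 'I_M.
have pi0 : (pi : R)%:C != 0 by rewrite eq_complex /= eqxx andbT gt_eqF ?pi_gt0.
have c0 i : (4 / pi)%:C * x i != 0.
  by rewrite mulf_neq0// rmorphM /= fmorphV mulf_neq0 ?invr_eq0// rmorph_nat.
(* The product expansion is thus [4 / pi] times the series of the claim, which accounts for the
   prefactor [pi / 4]. *)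
have termE i n : A i n / (p i n - t ^+ 2) * residue_factor p F s i n =
    (4 / pi)%:C * x i * term i n.
  have -> : term i n = (-1) ^+ n * (sin ((2 * n + 1)%:R * theta i))%:C /
    (p i n - t ^+ 2) * residue_factor p F s i n by [].
  rewrite /A /coef (rmorphM (real_complex R) ((-1) ^+ n)) rmorphXn /= rmorphN1.
  by rewrite !mulrA.
have [l hl] : exists l : 'I_M -> R[i], forall i, csum (term i) (l i).
  have ex i : exists l, csum (term i) l.
    have /abs_summable_csum[l hl] := term_summable F_csum F_summable p_separated F_uniform s (reg_t i).
    exists (((4 / pi)%:C * x i)^-1 * l); apply: eq_csum (csumZ _ hl) => n.
    by rewrite termE mulKf.
  by exists (fun i => projT1 (cid (ex i))) => i; case: cid.
have sl i : series (term i) @ \oo --> (l i : R[i]^o).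
  have -> : series (term i) = (fun n => \sum_(k < n) term i k).
    by apply/funext => n; rewrite /series /= big_mkord.
  by case: (hl i).
split=> [i|]; first by apply/cvg_ex; exists (l i); exact: sl.
have limE i : limn (series (term i)) = l i by apply: cvg_lim (sl i); exact: norm_hausdorff.
have s0 : s != [::].
  by apply/eqP => s0; have := mem_index_enum (Ordinal hM); rewrite -/s s0.
have prod_sum := csum_prod F_csum A_bounded F_summable p_separated F_uniform inv_uniform
  s0 (index_enum_uniq _) (fun i _ => reg_t i).
(* [csum_prod] sums over [i] inside the series. Each [term i] is summable by itself, so the finite
   sum may be moved outside, and uniqueness of limits identifies the two values. *)
have sum_lim : csum (fun n => \sum_(i <- s) (4 / pi)%:C * x i * term i n)
    (\sum_(i <- s) (4 / pi)%:C * x i * l i).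
  by apply: csum_sum => i _; exact: csumZ.
have sum_prod : csum (fun n => \sum_(i <- s) (4 / pi)%:C * x i * term i n)
    (\prod_(i < M) sin_over_zcos (theta i) (x i) (sqrtC (t ^+ 2 - a i ^+ 2))).
  by apply: eq_csum prod_sum => n; apply: eq_bigr => i _; exact: termE.
rewrite -(ccvg_unique sum_lim sum_prod).
rewrite mulr_sumr; apply: eq_bigr => i _; rewrite limE.
rewrite !rmorphM /= !fmorphV /= !rmorph_nat.
by move: pi0; move: (_%:C) => q q0; field.
Qed.
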